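(* Let $b$ be a prime, $n\in\mathbb{N}$ ($n\ge1$), $d=b^n$, $K=\mathbb{F}_b((x^{-1}))$, $A=\mathbb{F}_b[x]$. Let $p_d(z)=F_n(z)+x^{-1}\in K[z]$ with $$F_n(z)=\prod_{a_0,\dots,a_{n-1}\in\mathbb{F}_b}\bigl(z-(a_0+a_1x+\dots+a_{n-1}x^{n-1})\bigr),$$ let $\xi_1,\dots,\xi_d\in K$ be the $d$ distinct roots of $p_d$ in $K$, let $B=(\xi_i^{j-1})_{i,j=1}^d$, $T=(B^{-1})^\top$, and $\mathbb{X}=T(A^d)$. Then the lattice $\mathbb{X}$ is admissible. Furthermore, let $T=L'Q$ where $L'=(l'_{ij})\in K^{d\times d}$ is lower triangular and $Q\in\mathbb{F}_b[[x^{-1}]]^{d\times d}$ with $\det Q=1$, and let $\boldsymbol f=(f_1,\dots,f_d)\in A^d$ have nonzero entries and satisfy $\deg(f_j)\ge\max_{1\le i\le j}\deg(l'_{ji})$ for all $1\le j\le d$. Put $$m=\frac d2\Bigl(d\log_b d-(d-1)\frac{b}{b-1}\Bigr)+\sum_{j=1}^d\deg f_j$$ and assume $m\ge1$. Then $\mathcal{P}_{\boldsymbol f,d}=\boldsymbol f^{-1}\mathbb{X}\cap\mathbb{U}^d_b$ is a $(t,m,d)$-net in $\mathbb{U}^d_b$ for some integer $t$ with $$t\le\frac d2\Bigl(d\log_b d-(d-1)\frac{b}{b-1}\Bigr).$$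
   Context: $K=\mathbb{F}_b((x^{-1}))$ is the field of formal Laurent series $\sum_{i=w}^\infty c_ix^{-i}$ ($w\in\mathbb{Z}$, $c_i\in\mathbb{F}_b$), $A=\mathbb{F}_b[x]\subset K$. For $f=\sum_{i\ge w}c_ix^{-i}$ with $c_w\ne0$, $\deg(f)=-w$; $\deg(0)=-\infty$. $\mathbb{F}_b[[x^{-1}]]=\{f\in K:\deg f\le0\}$. $\mathbb{U}^d_b=\{(g_1,\dots,g_d)\in K^d:\deg(g_j)<0\ \forall j\}$. The polynomial $p_d$ has exactly $d$ distinct roots in $K$ and $B$ is invertible. $\boldsymbol f^{-1}\mathbb{X}=\{(f_1^{-1}g_1,\dots,f_d^{-1}g_d):(g_1,\dots,g_d)\in\mathbb{X}\}$. Dual lattice: $\mathbb{X}^\perp=\{\boldsymbol g\in K^d:\sum_jg_jh_j\in A\text{ for all }\boldsymbol h\in\mathbb{X}\}$. $M(\mathbb{X})=\inf_{\boldsymbol g\in\mathbb{X}^\perp\setminus\{\boldsymbol0\}}\sum_{j=1}^d\deg(g_j)$. $\mathbb{X}$ is admissible if $M(\mathbb{X})>-\infty$. $(t,m,d)$-net in $\mathbb{U}^d_b$: let $m\ge1$, $0\le t\le m$, $d\ge1$ be integers. A set $\mathcal{P}\subset\mathbb{U}_b^d$ of $b^m$ points is a $(t,m,d)$-net in $\mathbb{U}^d_b$ if for all nonnegative integers $l_1,\dots,l_d$ with $l_1+\dots+l_d=m-t$ and all $h_j\in\{c_1x^{-1}+\dots+c_{l_j}x^{-l_j}:c_i\in\mathbb{F}_b\}$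 ($1\le j\le d$), the set $\{\boldsymbol g\in\mathbb{U}_b^d:\deg(g_j-h_j)<-l_j\ \text{for all }1\le j\le d\}$ contains exactly $b^t$ points of $\mathcal{P}$. *)

(* Defs.v *)
From HB Require Import structures.
From mathcomp Require Import all_boot all_order all_algebra.
From mathcomp Require Import ring.
From mathcomp Require Import boolp classical_sets functions cardinality fsbigop.
From mathcomp Require Import constructive_ereal reals ereal exp.

Set Implicit Arguments.
Unset Strict Implicit.
Unset Printing Implicit Defensive.

Import Order.TTheory GRing.Theory Num.Theory.

Local Open Scope classical_set_scope.
Local Open Scope card_scope.
Local Open Scope ring_scope.

(* The formal Laurent series [\sum_(i >= w) c_i x^{-i}] is represented by its
   coefficients, [f i] being the coefficient of [x^{-i}]. *)
Record laurent (F : fieldType) := Laurent {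
  lcoef :> int -> F;
  lcoef_bounded : exists w : int, forall i : int, i < w -> lcoef i = 0 }.

HB.instance Definition _ (F : fieldType) := gen_eqMixin (laurent F).
HB.instance Definition _ (F : fieldType) := gen_choiceMixin (laurent F).

Section LaurentField.
Variable F : fieldType.
Implicit Types (f g h : laurent F) (w v i : int).

Lemma laurent_ext f g : (forall i, f i = g i) -> f = g.
Proof.
case: f g => [f Hf] [g Hg] /= /funext fg.
by move: Hf; rewrite fg => Hf; rewrite (Prop_irrelevance Hf Hg).
Qed.

Definition lbound w f := forall i, i < w -> f i = 0.

Lemma lbound_le w v f : v <= w -> lbound w f -> lbound v f.
Proof. by move=> vw fw i iv; apply: fw; apply: lt_le_trans iv vw. Qed.

Lemma lbound_ex f : exists w, lbound w f.
Proof. exact: lcoef_bounded. Qed.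

Lemma lbound_ex2 f g : exists w, lbound w f /\ lbound w g.
Proof.
have [[w Hw] [v Hv]] := (lbound_ex f, lbound_ex g).
exists (Num.min w v); split.
  by apply: lbound_le Hw; rewrite ge_min lexx.
by apply: lbound_le Hv; rewrite ge_min lexx orbT.
Qed.

Lemma int_shift w i : w <= i -> i = w + `|i - w|%N%:Z.
Proof. by move=> wi; rewrite gez0_abs ?subr_ge0 // [RHS]addrC subrK. Qed.

Lemma laurent_ext_bound w f g : lbound w f -> lbound w g ->
  (forall n : nat, f (w + n%:Z) = g (w + n%:Z)) -> f = g.
Proof.
move=> fw gw fg; apply: laurent_ext => i; have [/[dup] /fw -> /gw ->//|wi] := ltP i w.
rewrite (int_shift wi); exact: fg.
Qed.

Lemma lzero_bounded : exists w, forall i, i < w -> (fun=> 0 : F) i = 0.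
Proof. by exists 0. Qed.
Definition lzero := Laurent lzero_bounded.

Lemma lopp_bounded f : exists w, forall i, i < w -> - f i = 0.
Proof. by have [w fw] := lbound_ex f; exists w => i /fw ->; rewrite oppr0. Qed.
Definition lopp f := Laurent (lopp_bounded f).

Lemma ladd_bounded f g : exists w, forall i, i < w -> f i + g i = 0.
Proof.
have [w [fw gw]] := lbound_ex2 f g.
by exists w => i iw; rewrite fw // gw // addr0.
Qed.
Definition ladd f g := Laurent (ladd_bounded f g).

Fact laddA : associative ladd.
Proof. by move=> f g h; apply: laurent_ext => i /=; rewrite addrA. Qed.
Fact laddC : commutative ladd.
Proof. by move=> f g; apply: laurent_ext => i /=; rewrite addrC. Qed.
Fact ladd0 : left_id lzero ladd.
Proof. by move=> f; apply: laurent_ext => i /=; rewrite add0r. Qed.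
Fact laddN : left_inverse lzero lopp ladd.
Proof. by move=> f; apply: laurent_ext => i /=; rewrite addNr. Qed.

HB.instance Definition _ := GRing.isZmodule.Build (laurent F)
  laddA laddC ladd0 laddN.

(* The convolution product; the sum has finite support. *)
Definition lmul_coef f g (k : int) : F :=
  \sum_(i \in [set: int]) (f i * g (k - i)).

Lemma lmul_coef_lt w v f g k : lbound w f -> lbound v g -> k < w + v ->
  lmul_coef f g k = 0.
Proof.
move=> fw gv kwv; apply: fsbig1 => i _; have [/fw ->|wi] := ltP i w.
  by rewrite mul0r.
by rewrite gv ?mulr0 // ltrBlDr (lt_le_trans kwv) // addrC lerD2l.
Qed.

Lemma lmul_coef_sum w v f g (n : nat) : lbound w f -> lbound v g ->
  lmul_coef f g (w + v + n%:Z) =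
  \sum_(j < n.+1) f (w + j%:Z) * g (v + (n - j)%N%:Z).
Proof.
move=> fw gv; rewrite /lmul_coef.
pose r := [seq w + j%:Z | j <- iota 0 n.+1].
have ur : uniq r by rewrite map_inj_uniq ?iota_uniq // => i j /addrI [].
rewrite (fsbigE r) //; last first.
  move=> i _ ir; have [/fw ->|wi] := ltP i w; first by rewrite mul0r.
  rewrite gv ?mulr0 //; rewrite ltrBlDr addrAC addrC ltrD2l.
  rewrite ltNge; apply: contra ir => iwn; apply/mapP; exists `|i - w|%N.
    rewrite mem_iota /= add0n ltnS -lez_nat gez0_abs ?subr_ge0 //.
    by rewrite lerBlDl.
  exact: int_shift.
rewrite big_mkcond /= big_map -(big_mkord xpredT
  (fun j => f (w + j%:Z) * g (v + (n - j)%N%:Z))) /index_iota subn0.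
apply: eq_big_seq => j; rewrite mem_iota ltnS /= => jn.
rewrite in_setT; congr (_ * g _); rewrite -subzn //.
by ring.
Qed.

Lemma lmul_bounded f g : exists w, forall i, i < w -> lmul_coef f g i = 0.
Proof.
have [[w fw] [v gv]] := (lbound_ex f, lbound_ex g).
by exists (w + v) => i; apply: lmul_coef_lt.
Qed.
Definition lmul f g := Laurent (lmul_bounded f g).

Lemma lbound_mul w v f g : lbound w f -> lbound v g -> lbound (w + v) (lmul f g).
Proof. by move=> fw gv i; apply: lmul_coef_lt. Qed.

Lemma lone_bounded : exists w : int, forall i, i < w -> (i == 0)%:R = 0 :> F.
Proof. by exists 0 => i /lt_eqF ->. Qed.
Definition lone := Laurent lone_bounded.

Definition ltrunc w (N : nat) f : {poly F} := \poly_(k < N) f (w + k%:Z).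

Lemma lmul_trunc w v f g (n N : nat) : lbound w f -> lbound v g -> (n < N)%N ->
  lmul f g (w + v + n%:Z) = (ltrunc w N f * ltrunc v N g)`_n.
Proof.
move=> fw gv nN; rewrite /= (lmul_coef_sum n fw gv) coefM.
apply: eq_bigr => j _; rewrite !coef_poly (leq_trans (ltn_ord j) nN).
by rewrite (leq_ltn_trans (leq_subr j n) nN).
Qed.

Lemma coefM_eq (p p' q q' : {poly F}) (n : nat) :
  (forall k, (k <= n)%N -> p`_k = p'`_k) ->
  (forall k, (k <= n)%N -> q`_k = q'`_k) -> (p * q)`_n = (p' * q')`_n.
Proof.
move=> pp qq; rewrite !coefM; apply: eq_bigr => j _.
by rewrite pp -1?ltnS ?ltn_ord // qq ?leq_subr.
Qed.

Fact lmulC : commutative lmul.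
Proof.
move=> f g; have [[w fw] [v gv]] := (lbound_ex f, lbound_ex g).
apply: (@laurent_ext_bound (w + v)); first exact: lbound_mul.
  by rewrite addrC; apply: lbound_mul.
move=> n; rewrite (lmul_trunc fw gv (ltnSn n)) mulrC [w + v]addrC.
by rewrite (lmul_trunc gv fw (ltnSn n)).
Qed.

Fact lmulA : associative lmul.
Proof.
move=> f g h.
have [[[w fw] [v gv]] [u hu]] := (lbound_ex f, lbound_ex g, lbound_ex h).
have fgb := lbound_mul fw gv; have ghb := lbound_mul gv hu.
apply: (@laurent_ext_bound (w + v + u)).
- by rewrite -addrA; apply: lbound_mul fw ghb.
- exact: lbound_mul fgb hu.
move=> n; rewrite (lmul_trunc fgb hu (ltnSn n)) -[w + v + u]addrA.
rewrite (lmul_trunc fw ghb (ltnSn n)).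
transitivity ((ltrunc w n.+1 f * (ltrunc v n.+1 g * ltrunc u n.+1 h))`_n).
  apply: coefM_eq => // k kn; rewrite coef_poly ltnS kn.
  by rewrite (@lmul_trunc v u g h k n.+1).
rewrite mulrA; apply: coefM_eq => // k kn; rewrite [RHS]coef_poly ltnS kn.
by rewrite (@lmul_trunc w v f g k n.+1).
Qed.

Fact lmul1 : left_id lone lmul.
Proof.
move=> f; have [v fv] := lbound_ex f; have b1 : lbound 0 lone.
  by move=> i /= /lt_eqF ->.
apply: (@laurent_ext_bound v) => //; first by rewrite -[v]add0r; apply: lbound_mul.
move=> n; rewrite -{1}[v]add0r /= (lmul_coef_sum n b1 fv) big_ord_recl /=.
rewrite mul1r subn0 big1 ?addr0 // => j _.
by rewrite /= mul0r.
Qed.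

Fact lmulDl : left_distributive lmul +%R.
Proof.
move=> f g h; have [w [fw gw]] := lbound_ex2 f g; have [v hv] := lbound_ex h.
have fgw : lbound w (f + g) by move=> i iw; rewrite /= fw // gw // addr0.
apply: (@laurent_ext_bound (w + v)); first exact: lbound_mul.
  by move=> i iw; rewrite /= !(lmul_coef_lt _ hv iw) ?addr0.
move=> n; rewrite /= !(lmul_coef_sum n _ hv) // -big_split /=.
by apply: eq_bigr => j _; rewrite mulrDl.
Qed.

Fact lone_neq0 : lone != 0.
Proof.
apply/eqP => /(congr1 (fun f : laurent F => f 0)) /= /eqP.
by rewrite oner_eq0.
Qed.

HB.instance Definition _ := GRing.Zmodule_isComNzRing.Build (laurent F)
  lmulA lmulC lmul1 lmulDl lone_neq0.

(* [is_order f w] states that [x^{-w}] is the leading monomial of [f]. *)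
Definition is_order f w := f w != 0 /\ lbound w f.

Lemma is_order_ex f : f != 0 -> exists w, is_order f w.
Proof.
move=> f0; have [w fw] := lbound_ex f.
have [n fn] : exists n : nat, f (w + n%:Z) != 0.
  apply: contrapT => /forallNP f_0; move/eqP: f0; apply.
  apply: (@laurent_ext_bound w) => // n; apply/eqP/negPn/negP; exact: f_0.
have ex : exists n : nat, f (w + n%:Z) != 0 by exists n.
case: (ex_minnP ex) => k fk kmin; exists (w + k%:Z); split => // i ik.
have [/fw//|wi] := ltP i w; apply/eqP; apply: contraTT ik => fi.
have iE := int_shift wi.
by rewrite -leNgt iE lerD2l lez_nat kmin -?iE.
Qed.

Lemma is_order_uniq f w v : is_order f w -> is_order f v -> w = v.
Proof.
move=> [fw bw] [fv bv]; apply/eqP; rewrite eq_le !leNgt; apply/andP; split.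
  by apply/negP => /bw fv0; rewrite fv0 eqxx in fv.
by apply/negP => /bv fw0; rewrite fw0 eqxx in fw.
Qed.

Fixpoint linv_seq (a : nat -> F) (n : nat) : seq F :=
  if n is m.+1 then let s := linv_seq a m in
    rcons s ((a 0%N)^-1 * ((m == 0%N)%:R - \sum_(j < m) a j.+1 * s`_(m - j.+1)))
  else [::].

Lemma size_linv_seq a n : size (linv_seq a n) = n.
Proof. by elim: n => //= n IH; rewrite size_rcons IH. Qed.

Lemma nth_linv_seq a n k : (k < n)%N -> (linv_seq a n)`_k = (linv_seq a k.+1)`_k.
Proof.
elim: n => // n IH; rewrite ltnS leq_eqVlt => /predU1P[->//|kn].
by rewrite {1}/linv_seq -/linv_seq /= nth_rcons size_linv_seq kn IH.
Qed.

Lemma linv_seqP a n : a 0%N != 0 ->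
  \sum_(j < n.+1) a j * (linv_seq a (n - j).+1)`_(n - j) = (n == 0%N)%:R.
Proof.
move=> a0; rewrite big_ord_recl subn0 /= nth_rcons size_linv_seq ltnn eqxx.
rewrite mulrA divff // mul1r addrC; apply/eqP; rewrite addrCA -subr_eq0.
rewrite addrAC subrr add0r subr_eq0; apply/eqP; apply: eq_bigr => j _.
by rewrite /bump /= add1n -/(linv_seq a (n - j.+1).+1) -(@nth_linv_seq a n) // 
  ltn_subrL /= (leq_ltn_trans _ (ltn_ord j)).
Qed.

Lemma lmul_inv_ex f : f != 0 -> exists g, g * f = 1.
Proof.
move=> /is_order_ex [w [fw bw]].
pose a (k : nat) := f (w + k%:Z).
pose c (i : int) : F :=
  if i < - w then 0 else let k := absz (i + w) in (linv_seq a k.+1)`_k.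
have cb : exists v, forall i, i < v -> c i = 0 by exists (- w) => i; rewrite /c => ->.
pose g := Laurent cb; have bg : lbound (- w) g by move=> i; rewrite /= /c => ->.
exists g; rewrite mulrC; apply: (@laurent_ext_bound 0).
- by rewrite -(subrr w); apply: lbound_mul.
- by move=> i /= /lt_eqF ->.
move=> n; rewrite -{1}(subrr w) [LHS](lmul_coef_sum n bw bg) add0r /=.
rewrite eqz_nat -(@linv_seqP a n) ?/a ?addr0 //; apply: eq_bigr => j _.
have -> : c (- w + (n - j)%N%:Z) = (linv_seq a (n - j).+1)`_(n - j).
  rewrite /c ifF; last by rewrite ltNge lerDl.
  by have -> : - w + (n - j)%N%:Z + w = (n - j)%N%:Z by rewrite addrAC addNr add0r.
by [].
Qed.

Definition linv f : laurent F := xget 0 [set g | g * f = 1].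

Fact lmulVf f : f != 0 -> linv f * f = 1.
Proof.
by move=> /lmul_inv_ex [g gf]; rewrite /linv; case: xgetP => [h -> //|/(_ g)].
Qed.

Fact linv0 : linv 0 = 0.
Proof.
rewrite /linv; case: xgetP => // h _ /= /eqP.
by rewrite mulr0 eq_sym oner_eq0.
Qed.

HB.instance Definition _ := GRing.ComNzRing_isField.Build (laurent F) lmulVf linv0.

(* [deg f = - w] if [x^{-w}] is the leading monomial of [f]. *)
Definition deg f : \bar int :=
  if f == 0 then -oo%E else (- xget 0 [set w | is_order f w])%:E.

Lemma deg0 : deg 0 = -oo%E.
Proof. by rewrite /deg eqxx. Qed.

Lemma deg_order f w : is_order f w -> deg f = (- w)%:E.
Proof.
move=> fw; rewrite /deg; case: eqP => [f0|_].
  by case: fw; rewrite f0 eqxx.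
by case: xgetP => [v -> /is_order_uniq /(_ fw) ->//|/(_ w)].
Qed.

(* The inclusion of [F[x]] in [F((x^{-1}))]: the coefficient of [x^k] is the one
   of index [- k]. *)
Definition poly_coef (p : {poly F}) (i : int) : F :=
  if i <= 0 then p`_(absz i) else 0.

Lemma poly_coef_bounded (p : {poly F}) :
  exists w : int, forall i, i < w -> poly_coef p i = 0.
Proof.
exists (- (size p)%:Z) => i; rewrite /poly_coef; case: ifP => // i0 ip.
by apply: nth_default; rewrite -lez_nat lez0_abs // lerNr ltW.
Qed.
Definition lpoly (p : {poly F}) : laurent F := Laurent (poly_coef_bounded p).

Lemma lpoly_coefN p (k : nat) : lpoly p (- k%:Z) = p`_k.
Proof. by rewrite /= /poly_coef oppr_le0 abszN. Qed.

Lemma lpoly_coef_gt0 p i : 0 < i -> lpoly p i = 0.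
Proof. by rewrite /= /poly_coef ltNge; case: ifP. Qed.

Fact lpoly_is_zmod_morphism : zmod_morphism lpoly.
Proof.
move=> p q; apply: laurent_ext => i /=; rewrite /poly_coef.
by case: ifP; rewrite ?coefB ?subr0.
Qed.

Fact lpoly_is_monoid_morphism : monoid_morphism lpoly.
Proof.
split=> [|p q]; apply: laurent_ext => i.
  rewrite /= /poly_coef; case: ifP => [_|i0]; first by rewrite coef1 absz_eq0.
  by case: eqP i0 => // ->.
have [i0|i0] := leP i 0; last first.
  rewrite lpoly_coef_gt0 //; apply/esym; apply: fsbig1 => j _.
  have [j0|j0] := leP j 0; last by rewrite lpoly_coef_gt0 ?mul0r.
  by rewrite (@lpoly_coef_gt0 q) ?mulr0 // subr_gt0 (le_lt_trans j0).
have -> : i = - (absz i)%:Z by rewrite lez0_abs // opprK.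
move: (absz i) => k {i i0}; rewrite lpoly_coefN coefM /= /lmul_coef.
pose r := [seq - j%:Z | j <- iota 0 k.+1].
have ur : uniq r by rewrite map_inj_uniq ?iota_uniq // => a c /oppr_inj [].
rewrite (fsbigE r) //; last first.
  move=> i _ ir; have [i0|i0] := leP i 0; last by rewrite lpoly_coef_gt0 ?mul0r.
  rewrite (@lpoly_coef_gt0 q) ?mulr0 // subr_gt0 ltNge; apply: contra ir => ki.
  apply/mapP; exists (absz i); last by rewrite lez0_abs // opprK.
  by rewrite mem_iota /= add0n ltnS -lez_nat lez0_abs // lerNl.
rewrite [RHS]big_mkcond /= big_map -(big_mkord xpredT
  (fun j => p`_j * q`_(k - j))) /index_iota subn0.
apply: eq_big_seq => j; rewrite mem_iota ltnS /= => jk.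
rewrite in_setT -!lpoly_coefN -subzn //.
by congr (lpoly p _ * lpoly q _); rewrite opprB opprK addrC.
Qed.

HB.instance Definition _ := GRing.isZmodMorphism.Build {poly F} (laurent F) lpoly
  lpoly_is_zmod_morphism.
HB.instance Definition _ := GRing.isMonoidMorphism.Build {poly F} (laurent F) lpoly
  lpoly_is_monoid_morphism.

Definition lconst (c : F) : laurent F := lpoly c%:P.
Definition lX : laurent F := lpoly 'X.

Lemma lX_order : is_order lX (- 1).
Proof.
split; first by rewrite (lpoly_coefN 'X 1) coefX oner_eq0.
move=> i i1; rewrite /= /poly_coef; case: ifP => // i0.
rewrite coefX; case: eqP => // ai; move: i1.
by have := lez0_abs i0; rewrite ai => /(congr1 -%R); rewrite opprK => <-.
Qed.

Definition is_poly : set (laurent F) := range lpoly.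

End LaurentField.

Section Lattice.
Variables (F : fieldType) (d : nat).
Implicit Types (g h : 'cV[laurent F]_d) (X : set 'cV[laurent F]_d) (T : 'M[laurent F]_d).

Definition unit_cube : set 'cV[laurent F]_d :=
  [set g | forall j, (deg (g j 0%R) < 0)%E].

Definition poly_vectors : set 'cV[laurent F]_d :=
  [set a | forall j, is_poly (a j 0)].

Definition lattice_of T : set 'cV[laurent F]_d :=
  [set T *m a | a in poly_vectors].

Definition dual_lattice X : set 'cV[laurent F]_d :=
  [set g | forall h, X h -> is_poly (\sum_j g j 0 * h j 0)].

(* [R] is only the carrier of the extended line where the infimum is taken. *)
Definition min_degree (R : realType) X : \bar R :=
  ereal_inf [set (\sum_(j < d) er_map (fun z : int => z%:~R) (deg (g j 0%R)))%E
            | g in dual_lattice X `\ 0].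

Definition admissible (R : realType) X : Prop := (-oo < min_degree R X)%E.

Definition scale_inv (f : 'cV[laurent F]_d) X : set 'cV[laurent F]_d :=
  [set \col_j ((f j 0)^-1 * g j 0) | g in X].

End Lattice.
Arguments unit_cube {F d}.
Arguments poly_vectors {F d}.

Section Nets.
Variable b : nat.
Notation K := (laurent 'F_b).

(* The elements [c_1 x^{-1} + ... + c_l x^{-l}]. *)
Definition net_digits (l : nat) : set K :=
  [set \sum_(i < l) lconst (c i) * lX _ ^- i.+1 | c in [set: 'I_l -> 'F_b]].

Definition is_net (t m d : nat) (P : set 'cV[K]_d) : Prop :=
  [/\ [/\ (1 <= m)%N, (t <= m)%N & (1 <= d)%N], P `<=` unit_cube,
      P #= `I_(b ^ m) &
      forall (l : 'I_d -> nat) (h : 'I_d -> K),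
        (\sum_j l j)%N = (m - t)%N -> (forall j, net_digits (l j) (h j)) ->
        [set g | [/\ P g, unit_cube g &
          forall j, (deg (g j 0%R - h j)%R < (- (l j)%:Z)%:E)%E]] #= `I_(b ^ t)].

Definition Fpoly (n : nat) : {poly K} :=
  \prod_(a : {ffun 'I_n -> 'F_b}) ('X - (lpoly (\sum_(i < n) a i *: 'X^i))%:P).

Definition pd (n : nat) : {poly K} := Fpoly n + ((lX _)^-1)%:P.

Definition power_mx (d : nat) (xi : 'I_d -> K) : 'M[K]_d :=
  \matrix_(i, j) xi i ^+ j.

Definition lattice_mx (d : nat) (xi : 'I_d -> K) : 'M[K]_d :=
  (invmx (power_mx xi))^T.

Definition quality_bound (R : realType) (d : nat) : R :=
  d%:R / 2 * (d%:R * (ln d%:R / ln b%:R) - (d%:R - 1) * (b%:R / (b%:R - 1))).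

End Nets.

(* Main.v *)
(* Write [D = deg (det B)]; since [xi_j - xi_i] runs through the nonzero polynomials of
   degree less than [n], [D] is the claimed bound, and [t = D] works.

   The dual lattice of [X] is [B A^d], so its nonzero vectors are [(q(xi_1), ..., q(xi_d))]
   with [q] a nonzero polynomial over [A] of degree less than [d].  The inverses of the
   [xi_i] are the roots of a polynomial over [A] that is Eisenstein at [x]; hence the norm
   of [q] is nonzero and has degree at least [1 - d].

   The decomposition [T = L Q] gives [b^(D + sum_j deg f_j)] points of [X] with
   [deg g_j < deg f_j].  Prescribing [l_j] leading digits of each [g_j / f_j], where
   [sum_j l_j = sum_j deg f_j], is a linear map from these points to the digits.  If it
   were not onto, a linear form vanishing on its image would extend to one vanishing on
   [X]; it is the residue of the product with a dual vector satisfying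
   [deg g_j < l_j - deg f_j], whose degrees sum to at most [-d], a contradiction.  So all
   fibers have [b^D] elements. *)

Require Import Defs.
From mathcomp Require Import all_boot all_order all_algebra.
From mathcomp Require Import zify ring.
From mathcomp Require Import boolp classical_sets functions cardinality.
From mathcomp Require Import constructive_ereal reals ereal exp.

Import Order.TTheory GRing.Theory Num.Theory.

Local Open Scope classical_set_scope.
Local Open Scope card_scope.
Local Open Scope ring_scope.

Set Implicit Arguments.
Unset Strict Implicit.
Unset Printing Implicit Defensive.

(* [classical_sets] shadows the name. *)
Local Notation lbound := Defs.lbound.

(** * Orders and integral parts of Laurent series *)

Section LaurentOrder.
Variable F : fieldType.
Implicit Types (f g h : laurent F) (p q : {poly F}) (w v i : int).

Lemma lbound_orderE f w v : is_order f w -> lbound v f <-> v <= w.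
Proof.
move=> [fw bw]; split=> [bv|vw]; last exact: lbound_le bw.
by rewrite leNgt; apply/negP => /bv fw0; rewrite fw0 eqxx in fw.
Qed.

Lemma is_orderM f g w v : is_order f w -> is_order g v -> is_order (f * g) (w + v).
Proof.
move=> [fw bw] [gv bv]; split; last exact: lbound_mul.
have /= := @lmul_coef_sum _ w v f g 0 bw bv.
by rewrite big_ord1 !addr0 => ->; rewrite mulf_neq0.
Qed.

(** The valuation at infinity, minus the degree. It takes the default value 0 at 0, so product rules
    need nonzero factors, whereas [lbound] treats 0 like any other series. *)
Definition ord f : int := xget 0 [set w | is_order f w].

Lemma ordP f : f != 0 -> is_order f (ord f).
Proof. by move=> /is_order_ex[w fw]; rewrite /ord; case: xgetP => [v -> //|/(_ w)]. Qed.

Lemma ord_eq f w : is_order f w -> ord f = w.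
Proof.
move=> fw; apply: (@is_order_uniq _ f) => //; apply: ordP.
by case: fw => fw _; apply: contra_neq fw => ->.
Qed.

Lemma lbound_ordE f w : f != 0 -> lbound w f <-> w <= ord f.
Proof. by move=> /ordP/lbound_orderE. Qed.

Lemma ordM f g : f != 0 -> g != 0 -> ord (f * g) = ord f + ord g.
Proof. by move=> /ordP f0 /ordP g0; apply/ord_eq/is_orderM. Qed.

Lemma ord1 : ord (1 : laurent F) = 0.
Proof.
apply: ord_eq; split; first by rewrite /= oner_neq0.
by move=> i /= /lt_eqF ->.
Qed.

Lemma ordV f : f != 0 -> ord f^-1 = - ord f.
Proof.
move=> f0; have fV0 : f^-1 != 0 by rewrite invr_eq0.
by have := ordM fV0 f0; rewrite mulVf // ord1 => /esym/eqP; rewrite addr_eq0 => /eqP.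
Qed.

Lemma ordN f : ord (- f) = ord f.
Proof.
rewrite /ord; congr (xget 0 _); apply/seteqP.
have H g w : is_order g w -> is_order (- g) w.
  by case=> gw bw; split; [rewrite /= oppr_eq0 | move=> i /bw /= ->; rewrite oppr0].
by split=> w /H //=; rewrite opprK.
Qed.

Lemma ord_prod (I : Type) (r : seq I) (P : pred I) (E : I -> laurent F) :
  (forall k, P k -> E k != 0) ->
  ord (\prod_(k <- r | P k) E k) = \sum_(k <- r | P k) ord (E k).
Proof.
move=> E0; suff [] : \prod_(k <- r | P k) E k != 0 /\
  ord (\prod_(k <- r | P k) E k) = \sum_(k <- r | P k) ord (E k) by [].
elim/big_ind2: _ => [|x y z t [x0 <-] [y0 <-]|k Pk]; first by rewrite oner_neq0 ord1.
  by rewrite mulf_neq0 // ordM.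
by split => //; apply: E0.
Qed.

Lemma ordX f n : f != 0 -> ord (f ^+ n) = ord f *+ n.
Proof.
move=> f0; elim: n => [|n IH]; first by rewrite expr0 ord1.
by rewrite exprS mulrS ordM ?expf_neq0 // IH.
Qed.

Lemma degE f : f != 0 -> deg f = (- ord f)%:E.
Proof. by move=> /ordP/deg_order. Qed.

Lemma deg_ltP f (e : int) : (deg f < e%:E)%E <-> lbound (1 - e) f.
Proof.
have [->|f0] := eqVneq f 0; first by rewrite deg0 ltNyr; split.
rewrite degE // lte_fin lbound_ordE //; split; lia.
Qed.

Lemma deg_leP f (e : int) : (deg f <= e%:E)%E <-> lbound (- e) f.
Proof.
have [->|f0] := eqVneq f 0; first by rewrite deg0 leNye; split.
rewrite degE // lee_fin lbound_ordE //; split; lia.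
Qed.

Lemma lboundD w f g : lbound w f -> lbound w g -> lbound w (f + g).
Proof. by move=> fw gw i iw; rewrite /= fw ?gw ?addr0. Qed.

Lemma lboundN w f : lbound w f -> lbound w (- f).
Proof. by move=> fw i iw; rewrite /= fw ?oppr0. Qed.

Lemma lboundB w f g : lbound w f -> lbound w g -> lbound w (f - g).
Proof. by move=> fw /lboundN; apply: lboundD. Qed.

Lemma lbound_sum w (I : Type) (r : seq I) (P : pred I) (E : I -> laurent F) :
  (forall k, P k -> lbound w (E k)) -> lbound w (\sum_(k <- r | P k) E k).
Proof. by move=> Ew; elim/big_ind: _ => // f g; apply: lboundD. Qed.

Lemma lboundM w v f g : lbound w f -> lbound v g -> lbound (w + v) (f * g).
Proof. exact: lbound_mul. Qed.

Lemma lbound_mull w f g : f != 0 -> lbound w (f * g) <-> lbound (w - ord f) g.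
Proof.
move=> f0; have [->|g0] := eqVneq g 0; first by rewrite mulr0; split.
rewrite !lbound_ordE ?mulf_neq0 // ordM //; split; lia.
Qed.

Lemma lpoly_inj : injective (@lpoly F).
Proof.
move=> p q pq; apply/polyP => k.
by rewrite -!lpoly_coefN pq.
Qed.

Lemma lpoly_eq0 p : (lpoly p == 0) = (p == 0).
Proof. by rewrite -[X in _ == X](rmorph0 (@lpoly F)) (inj_eq lpoly_inj). Qed.

Lemma lbound_lpoly p (n : nat) : lbound (1 - n%:Z) (lpoly p) <-> (size p <= n)%N.
Proof.
split=> [bp|pn i ip].
  apply/leq_sizeP => k nk; rewrite -lpoly_coefN bp //; lia.
rewrite /= /poly_coef; case: ifP => // i0; apply: nth_default.
apply: leq_trans pn _; lia.
Qed.

Lemma ord_lpoly p : p != 0 -> ord (lpoly p) = 1 - (size p)%:Z.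
Proof.
move=> p0; apply: ord_eq; split; last exact/lbound_lpoly.
rewrite -size_poly_gt0 in p0.
have -> : 1 - (size p)%:Z = - (size p).-1%:Z by lia.
by rewrite lpoly_coefN -lead_coefE lead_coef_eq0 -size_poly_gt0.
Qed.

Lemma lbound1_lpoly p : lbound 1 (lpoly p) -> p = 0.
Proof. by rewrite -[1]subr0 => /(lbound_lpoly p 0); rewrite leqn0 size_poly_eq0 => /eqP. Qed.

Lemma lfloor_ex f : exists p, lbound 1 (f - lpoly p).
Proof.
have [w fw] := lbound_ex f.
exists (\poly_(k < `|w|.+1) f (- k%:Z)) => i i1.
rewrite /= /poly_coef; have i0 : i <= 0 by lia.
rewrite i0 coef_poly; case: ltnP => iw.
  by rewrite lez0_abs // opprK subrr.
by rewrite subr0; apply: fw; lia.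
Qed.

Definition lfloor f : {poly F} := xget 0 [set p | lbound 1 (f - lpoly p)].

Lemma lfloorP f : lbound 1 (f - lpoly (lfloor f)).
Proof.
by have [p fp] := lfloor_ex f; rewrite /lfloor; case: xgetP => [q ->|/(_ p)].
Qed.

(** Two candidates for the integral part differ by a polynomial of negative degree, which is 0. *)
Lemma lfloor_eq f p : lbound 1 (f - lpoly p) -> lfloor f = p.
Proof.
move=> fp; apply/eqP; rewrite -subr_eq0; apply/eqP/lbound1_lpoly.
rewrite rmorphB /=.
have -> : lpoly (lfloor f) - lpoly p = (f - lpoly p) - (f - lpoly (lfloor f)) by ring.
by apply: lboundB => //; apply: lfloorP.
Qed.

Lemma lfloorDl f p : lfloor (lpoly p + f) = p + lfloor f.
Proof.
apply: lfloor_eq; rewrite rmorphD /=.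
have -> : lpoly p + f - (lpoly p + lpoly (lfloor f)) = f - lpoly (lfloor f) by ring.
exact: lfloorP.
Qed.

Lemma is_polyP f : is_poly f <-> forall i, 0 < i -> f i = 0.
Proof.
split=> [[p _ <-] i|f0]; first exact: lpoly_coef_gt0.
exists (lfloor f) => //; apply/eqP; rewrite eq_sym -subr_eq0; apply/eqP.
apply: laurent_ext => i; have [i1|i1] := ltP i 1; first exact: lfloorP.
have i0 : 0 < i by lia.
change (f i - lpoly (lfloor f) i = 0).
by rewrite f0 // lpoly_coef_gt0 // subr0.
Qed.

Lemma monomial_bounded w : exists v, forall i, i < v -> (i == w)%:R = 0 :> F.
Proof. by exists w => i /lt_eqF ->. Qed.
Definition monomial w : laurent F := Laurent (monomial_bounded w).

Lemma is_order_monomial w : is_order (monomial w) w.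
Proof. by split=> [|i /lt_eqF /= ->] //=; rewrite eqxx oner_neq0. Qed.

Lemma coef_monomialM w f i : (monomial w * f) i = f (i - w).
Proof.
have [v fv] := lbound_ex f; have [_ mw] := is_order_monomial w.
have [iwv|] := ltP i (w + v).
  by rewrite (lboundM mw fv) // fv //; lia.
move=> wvi; have -> : i = w + v + (absz (i - (w + v))%R)%:Z by lia.
set n := absz _.
rewrite [LHS](lmul_coef_sum n mw fv) big_ord_recl big1 ?addr0; last first.
  move=> j _ /=; have -> : (w + (bump 0 j)%:Z == w) = false by rewrite /bump; lia.
  by rewrite mul0r.
rewrite /= eqxx mul1r subn0; congr (f _); lia.
Qed.

Lemma coef_lconstM c f i : (lconst c * f) i = c * f i.
Proof.
have [v fv] := lbound_ex f.
have c0 : lbound 0 (lconst c).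
  rewrite -(subrr 1); apply/(lbound_lpoly _ 1); exact: size_polyC_leq1.
have [iv|vi] := ltP i v.
  by rewrite (lboundM c0 fv) ?fv ?mulr0 // add0r.
have -> : i = 0 + v + (absz (i - v)%R)%:Z by lia.
set n := absz _.
rewrite [LHS](lmul_coef_sum n c0 fv) big_ord_recl big1 ?addr0; last first.
  move=> j _; rewrite /lconst lpoly_coef_gt0 ?mul0r // /bump; lia.
congr (_ * f _); last by rewrite /=; lia.
by have := lpoly_coefN c%:P 0; rewrite coefC eqxx.
Qed.

Lemma lX_monomial (k : nat) : lX F ^+ k = monomial (- k%:Z).
Proof.
rewrite /lX -rmorphXn /=; apply: laurent_ext => i /=; rewrite /poly_coef coefXn.
case: ifP => i0; first by congr (nat_of_bool _)%:R; lia.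
by have -> : (i == - k%:Z) = false by lia.
Qed.

End LaurentOrder.

(** * Norms of polynomials in the roots *)

Lemma det_Vandermonde_neq0 (R : idomainType) (m : nat) (a : 'rV[R]_m) :
  injective (a 0) -> \det (Vandermonde m a) != 0.
Proof.
move=> a_inj; rewrite det_Vandermonde; apply/prodf_neq0 => i _; apply/prodf_neq0 => j ij.
by rewrite subr_eq0; apply: contraTneq ij => /a_inj ->; rewrite ltnn.
Qed.

(** * Norms at the roots of a polynomial that is Eisenstein at x *)

Section EisensteinNorm.
Variables (F : fieldType) (n : nat).
Local Notation A := {poly F}.
Local Notation K := (laurent F).
Local Notation d := n.+1.
Local Notation lift := (map_poly (@lpoly F)).
Variables (s : {poly A}) (u : 'I_d -> K).
Hypotheses (s_size : (size s <= d)%N) (s0 : s`_0 = 1) (u_inj : injective u).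

Local Notation P := ('X^d + 'X%:P * s : {poly A}).
Hypothesis u_root : forall i, (lift P).[u i] = 0.

Lemma eisenstein_eval i : lX F * (lift s).[u i] = - u i ^+ d.
Proof.
have := u_root i; rewrite rmorphD rmorphM /= map_polyXn map_polyC /=.
by rewrite hornerD hornerXn hornerM hornerC addrC => /eqP; rewrite addr_eq0 => /eqP.
Qed.

Lemma size_XpolyC_mul : (size ('X%:P * s : {poly A})%R <= d)%N.
Proof. by rewrite mul_polyC; apply: leq_trans (size_scale_leq _ _) s_size. Qed.

Lemma eisenstein_monic : P \is monic.
Proof.
by rewrite monicE lead_coefDl ?lead_coefXn // size_polyXn ltnS size_XpolyC_mul.
Qed.

Lemma size_eisenstein : size P = d.+1.
Proof. by rewrite size_polyDl size_polyXn // ltnS size_XpolyC_mul. Qed.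

Lemma eisenstein_prod : lift P = \prod_i ('X - (u i)%:P).
Proof.
have uP : uniq_roots [seq u i | i <- enum 'I_d].
  by rewrite uniq_rootsE map_inj_uniq ?enum_uniq.
have := @all_roots_prod_XsubC _ (lift P) [seq u i | i <- enum 'I_d].
rewrite size_map_inj_poly ?rmorph0 //; last exact: lpoly_inj.
rewrite size_eisenstein size_map size_enum_ord => /(_ erefl) ->; first last.
- exact: uP.
- by apply/allP => _ /mapP[i _ ->]; apply/rootP/u_root.
have -> : lead_coef (lift P) = 1.
  by apply/eqP; rewrite -monicE monic_map ?eisenstein_monic.
by rewrite scale1r big_map big_enum.
Qed.

(** Compare constant terms: that of [P] is x because of [s0]. Hence the roots are nonzero and their
    orders add up to -1. *)
Lemma prod_eisenstein_roots : \prod_i u i = (-1) ^+ d * lX F.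
Proof.
have := congr1 (horner^~ 0) eisenstein_prod.
rewrite horner_prod (eq_bigr (fun i => - u i)); last first.
  by move=> i _; rewrite hornerXsubC sub0r.
rewrite prodrN card_ord rmorphD rmorphM /= map_polyXn map_polyC /=.
rewrite hornerD hornerXn expr0n add0r hornerM hornerC horner_coef0 coef_map s0 /= rmorph1 mulr1.
by rewrite /lX => ->; rewrite mulrA -exprD addnn -signr_odd odd_double mul1r.
Qed.

Lemma eisenstein_root_neq0 i : u i != 0.
Proof.
have : \prod_i u i != 0.
  rewrite prod_eisenstein_roots mulf_neq0 ?signr_eq0 //.
  by rewrite /lX lpoly_eq0 polyX_eq0.
by move/prodf_neq0 => /(_ i isT).
Qed.

(** Multiplication by the indeterminate modulo [P], as a matrix over A. In this convention the
    columns of [root_powers] are right eigenvectors. *)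
Definition companion : 'M[A]_d :=
  \matrix_(i, j) if (i.+1 < d)%N then (j == i.+1 :> nat)%:R else - P`_j.

Definition root_powers : 'M[K]_d := \matrix_(i, j) u j ^+ i.

Lemma root_powers_unit : root_powers \in unitmx.
Proof.
have -> : root_powers = Vandermonde d (\row_j u j).
  by apply/matrixP => i j; rewrite !mxE.
by rewrite unitmxE unitfE det_Vandermonde_neq0 // => i j; rewrite !mxE => /u_inj.
Qed.

(** All rows but the last shift the powers of [u k]; the last row expresses [P(u k) = 0]. *)
Lemma companion_diag : map_mx (@lpoly F) companion =
  root_powers *m diag_mx (\row_j u j) *m invmx root_powers.
Proof.
apply: (canRL (mulmxK root_powers_unit)).
apply/matrixP => i k; rewrite mul_mx_diag !mxE -exprSr.
under eq_bigr do rewrite !mxE.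
case: ltnP => [id|di].
  rewrite (bigD1 (Ordinal id)) //= eqxx rmorph1 mul1r big1 ?addr0 // => j ji.
  rewrite [_ == _](_ : _ = false) ?rmorph0 ?mul0r //.
  by apply: contraNF ji => /eqP ji; apply/eqP/val_inj.
have -> : i.+1 = d by apply/eqP; rewrite eqn_leq di andbT ltn_ord.
have := u_root k; rewrite horner_coef size_map_inj_poly ?rmorph0 //; last exact: lpoly_inj.
rewrite size_eisenstein big_ord_recr /= coef_map.
have /eqP := eisenstein_monic; rewrite lead_coefE size_eisenstein /= => ->.
rewrite rmorph1 mul1r addrC => /eqP; rewrite addr_eq0 => /eqP ->.
by rewrite -sumrN; apply: eq_bigr => j _; rewrite coef_map /= rmorphN mulNr.
Qed.

Lemma lift_horner_companion (r : {poly A}) :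
  map_mx (@lpoly F) (horner_mx companion r) =
  root_powers *m diag_mx (\row_j (lift r).[u j]) *m invmx root_powers.
Proof.
rewrite map_horner_mx companion_diag horner_mx_uconj ?root_powers_unit //.
rewrite horner_mx_diag (_ : map_mx _ _ = \row_j (lift r).[u j]) //.
by apply/rowP => j; rewrite !mxE.
Qed.

(** The norm of [r] is thus the determinant of a matrix over A, hence a polynomial in x: once
    nonzero, its degree is nonnegative. *)
Lemma lift_det_horner (r : {poly A}) :
  lpoly (\det (horner_mx companion r)) = \prod_i (lift r).[u i].
Proof.
rewrite -det_map_mx lift_horner_companion !det_mulmx det_inv det_diag mulrAC.
rewrite divrr ?mul1r -?unitmxE ?root_powers_unit //.
by apply: eq_bigr => i _; rewrite mxE.
Qed.

(** Cayley-Hamilton, read off from the diagonalization over K, where [P] kills every eigenvalue. *)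
Lemma companion_eisenstein : horner_mx companion P = 0.
Proof.
have : map_mx (@lpoly F) (horner_mx companion P) = 0.
  rewrite lift_horner_companion (_ : \row_j _ = 0).
    by rewrite linear0 mulmx0 mul0mx.
  by apply/rowP => j; rewrite mxE u_root mxE.
move=> /matrixP H; apply/matrixP => i j; apply: lpoly_inj.
by have := H i j; rewrite !mxE => ->; rewrite rmorph0.
Qed.

(* Modulo [x] the companion matrix is nilpotent. *)
Lemma det_horner_companion_neq0 (h : {poly A}) :
  (h`_0).[0] != 0 -> \det (horner_mx companion h) != 0.
Proof.
move=> h0; pose ev : {rmorphism {poly F} -> F} := horner_eval (0 : F).
pose C0 := map_mx ev companion.
have C0d : horner_mx C0 'X^d = 0.
  have := congr1 (map_mx ev) companion_eisenstein.
  rewrite map_horner_mx map_mx0 rmorphD rmorphM /= map_polyXn map_polyC /=.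
  by rewrite /ev /= /horner_eval hornerX mul0r addr0.
(* Modulo x, [h] has a nonzero constant term, so it is coprime to [X^d]. As [C0^d = 0], a Bezout
   relation evaluated at [C0] makes [h(C0)] invertible. *)
have cop : coprimep (map_poly ev h) 'X^d.
  rewrite coprimep_expr // coprimepX.
  by rewrite rootE horner_coef0 coef_map.
have /Bezout_coprimepP[[a c]] := cop.
rewrite /= => /eqpP[[c1 c2] /= /andP[c1_0 c2_0]].
move=> /(congr1 (horner_mx C0)); rewrite !linearZ /= rmorphD !rmorphM /= C0d mulr0 addr0.
rewrite rmorph1 => /(congr1 determinant); rewrite !detZ det1 mulr1 => e.
apply/eqP => /(congr1 ev); rewrite rmorph0 -det_map_mx map_horner_mx => dh.
move: e; rewrite det_mulmx dh mulr0 mulr0 => /esym/eqP.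
by rewrite expf_eq0 (negPf c2_0) andbF.
Qed.

Lemma polyX_factor (r : {poly A}) : (forall i, (r`_i).[0] = 0) ->
  exists r', r = 'X%:P * r'.
Proof.
move=> r0; exists (\poly_(i < size r) (r`_i %/ 'X)).
apply/polyP => i; rewrite coefCM coef_poly; case: ltnP => ir.
  by rewrite mulrC divpK // -['X]subr0 -polyC0 dvdp_XsubCl; apply/rootP.
by rewrite mulr0 nth_default.
Qed.

(* If [r = X^j t + x s'] with [x] not dividing [t_0], then
   [s(u) r(u) = u^j h(u)] with [h = s t - X^(d-j) s'], because [x s(u) = - u^d]. *)
Lemma horner_eisenstein_root_neq0 (r : {poly A}) i :
  r != 0 -> (size r <= d)%N -> (lift r).[u i] != 0.
Proof.
(* Induction on the x-degree of the leading coefficient: removing a common factor x lowers it by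
   one. *)
move: {-1}(size (lead_coef r)) (leqnn (size (lead_coef r))) => m.
elim: m r => [|m IH] r.
  by rewrite leqn0 size_poly_eq0 lead_coef_eq0 => ->.
move=> rm r0 rd.
have [/polyX_factor[r' rE]|] := pselect (forall k, (r`_k).[0] = 0).
  have r'0 : r' != 0 by apply: contraNneq r0 => r'0; rewrite rE r'0 mulr0.
  have sr : size r = size r' by rewrite rE size_Cmul ?polyX_eq0.
  rewrite rE rmorphM /= map_polyC hornerM hornerC mulf_neq0 //.
    by rewrite lpoly_eq0 polyX_eq0.
  apply: IH => //; last by rewrite -sr.
  move: rm; rewrite rE lead_coefM lead_coefC size_mul ?polyX_eq0 ?lead_coef_eq0 //.
  by rewrite size_polyX.
move=> /existsNP[k0 /eqP rk0].
have ex : exists k, (r`_k).[0] != 0 by exists k0.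
case: (ex_minnP ex) => j rj jmin.
have jd : (j < d)%N.
  apply: leq_trans rd; rewrite ltnNge; apply: contra rj => rj.
  by rewrite nth_default ?horner0.
have [k|s' s'E] := @polyX_factor (take_poly j r).
  rewrite coef_take_poly; case: ltnP => [kj|]; last by rewrite horner0.
  by apply/eqP; apply: contraTT kj => /jmin; rewrite leqNgt.
have rE := poly_take_drop j r; rewrite s'E in rE.
set t := drop_poly j r in rE.
pose h := s * t - 'X^(d - j) * s'.
(* As [s0] holds and [j < d], the constant coefficient of [h] is the [j]-th one of [r], which x does
   not divide. *)
have h0 : (h`_0).[0] != 0.
  rewrite /h coefB !coef0M s0 mul1r coefXn coef_drop_poly add0n.
  by rewrite ltn_eqF ?subn_gt0 // mul0r subr0.
(* A zero of [r] at [u i] would give one of [h], and then the norm of [h] would vanish. *)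
have /eqP := det_horner_companion_neq0 h0; apply: contra_not_neq => ru.
apply: lpoly_inj; rewrite lift_det_horner rmorph0 (bigD1 i) //=.
suff -> : (lift h).[u i] = 0 by rewrite mul0r.
have uj0 : u i ^+ j != 0 by rewrite expf_neq0 ?eisenstein_root_neq0.
apply: (mulfI uj0); rewrite mulr0.
have : (lift s).[u i] * (lift r).[u i] = 0 by rewrite ru mulr0.
move=> <-; rewrite -rE /h rmorphB rmorphD !rmorphM /= !map_polyXn map_polyC /=.
rewrite !(hornerD, hornerN, hornerM, hornerXn, hornerC) -/(lX F).
have ud : u i ^+ d = u i ^+ j * u i ^+ (d - j) by rewrite -exprD subnKC // ltnW.
transitivity ((lift s).[u i] * (lift t).[u i] * u i ^+ j - u i ^+ d * (lift s').[u i]).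
  by rewrite ud; ring.
by rewrite -mulNr -eisenstein_eval; ring.
Qed.

Lemma ord_prod_eisenstein (r : {poly A}) : r != 0 -> (size r <= d)%N ->
  ord (\prod_i (lift r).[u i]) <= 0.
Proof.
move=> r0 rd; rewrite -lift_det_horner.
have det0 : \det (horner_mx companion r) != 0.
  rewrite -lpoly_eq0 lift_det_horner.
  by apply/prodf_neq0 => i _; apply: horner_eisenstein_root_neq0.
by rewrite ord_lpoly // subr_le0 lez_nat size_poly_gt0.
Qed.

End EisensteinNorm.

(** * From the inverses of the [xi i] back to the [xi i], by reversal of polynomials *)

Section RootNorm.
Variables (F : fieldType) (n : nat).
Local Notation A := {poly F}.
Local Notation K := (laurent F).
Local Notation d := n.+1.
Local Notation lift := (map_poly (@lpoly F)).

(** This stands for [z^n p(1/z)] with the fixed exponent [n], whatever the actual degree of [p],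
    provided it is at most [n]. *)
Definition reversal (R : nzRingType) (p : {poly R}) : {poly R} :=
  \poly_(j < d) p`_(n - j).

Lemma horner_reversal (p : {poly A}) (z : K) : (size p <= d)%N -> z != 0 ->
  (lift (reversal p)).[z^-1] = z ^- n * (lift p).[z].
Proof.
move=> pd z0.
have szl (r : {poly A}) : (size r <= d)%N -> (size (lift r) <= d)%N.
  by apply: leq_trans; apply: size_poly.
rewrite !(@horner_coef_wide _ d) ?szl //; last exact: size_poly.
rewrite mulr_sumr (reindex_inj rev_ord_inj) /=; apply: eq_bigr => j _.
rewrite !coef_map /= coef_poly subSS ltnS leq_subr.
have jn : (j <= n)%N by rewrite -ltnS.
rewrite subKn // mulrCA; congr (_ * _); apply: (mulfI (expf_neq0 n z0)).
have zn : z ^+ n = z ^+ j * z ^+ (n - j) by rewrite -exprD subnKC.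
by rewrite mulVKf ?expf_neq0 // zn exprVn mulfK ?expf_neq0.
Qed.

Lemma reversal_neq0 (p : {poly A}) : p != 0 -> (size p <= d)%N -> reversal p != 0.
Proof.
move=> p0 pd; apply: contra_neq p0 => rp0; apply/polyP => j; rewrite coef0.
have [jd|dj] := ltnP j d; last by rewrite nth_default // (leq_trans pd).
have := congr1 (fun r : {poly A} => r`_(n - j)) rp0.
by rewrite coef_poly ltnS leq_subr coef0 subKn.
Qed.

Variables (G : {poly A}) (xi : 'I_d -> K).
Hypotheses (G_monic : G \is monic) (G_size : size G = d.+1) (G0 : G`_0 = 0).
Hypotheses (xi_inj : injective xi).
Hypothesis xi_root : forall i, (lift G).[xi i] = - (lX F)^-1.

Local Notation g := (drop_poly 1 G).
Local Notation u := (fun i => (xi i)^-1).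

Lemma lX_neq0 : lX F != 0.
Proof. by rewrite /lX lpoly_eq0 polyX_eq0. Qed.

Lemma shifted_root_neq0 i : xi i != 0.
Proof.
apply/eqP => xi0; have /eqP := xi_root i.
rewrite xi0 horner_coef0 coef_map G0 /= rmorph0 eq_sym oppr_eq0 invr_eq0.
by rewrite (negPf lX_neq0).
Qed.

(** Write [G = z g]. The equation at [z = xi i] reads [x g(z) = - z^-1]; dividing by [z^n] gives
    [x rev(g)(z^-1) = - z^-d]. *)
Lemma reversal_eisenstein_root i :
  (lift ('X^d + 'X%:P * reversal g)).[(xi i)^-1] = 0.
Proof.
have xi0 := shifted_root_neq0 i.
have GE : G = g * 'X.
  rewrite -['X]expr1 -{1}(poly_take_drop 1 G) (_ : take_poly 1 G = 0) ?add0r //.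
  by apply/polyP => -[|k]; rewrite coef_take_poly coef0.
rewrite rmorphD rmorphM /= map_polyXn map_polyC /= -/(lX F).
rewrite hornerD hornerXn hornerM hornerC horner_reversal //; last first.
  by rewrite size_drop_poly G_size subn1.
have := xi_root i; rewrite {1}GE rmorphM /= map_polyX hornerM hornerX => gx.
have -> : (lift g).[xi i] = - (lX F)^-1 * (xi i)^-1 by rewrite -gx mulfK.
rewrite exprSr exprVn mulrCA [lX F * _]mulrA mulrN divff ?lX_neq0 // mulN1r mulrN.
by rewrite subrr.
Qed.

(** Each [q(xi i)] is [xi i ^ n] times the reversal of [q] at the inverse of [xi i]. The inverses
    multiply to x up to sign, so the product of the [xi i] has order 1 and contributes [n]; the norm
    of the reversal has order at most 0. *)
Lemma root_norm (q : {poly A}) : q != 0 -> (size q <= d)%N ->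
  \prod_i (lift q).[xi i] != 0 /\ ord (\prod_i (lift q).[xi i]) <= n%:Z.
Proof.
move=> q0 qd.
have s_size : (size (reversal g) <= d)%N by apply: size_poly.
have s0 : (reversal g)`_0 = 1.
  rewrite coef_poly /= subn0 coef_drop_poly addn1.
  by move/monicP: G_monic; rewrite lead_coefE G_size.
have u_inj : injective u by move=> i j /invr_inj /xi_inj.
have r0 := reversal_neq0 q0 qd; have rd : (size (reversal q) <= d)%N by apply: size_poly.
have u0 i : (xi i)^-1 != 0 by rewrite invr_eq0 shifted_root_neq0.
have ru i := horner_eisenstein_root_neq0 s_size s0 u_inj reversal_eisenstein_root i r0 rd.
have qE i : (lift q).[xi i] = xi i ^+ n * (lift (reversal q)).[(xi i)^-1].
  by rewrite horner_reversal ?shifted_root_neq0 // mulVKf // expf_neq0 // shifted_root_neq0.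
split.
  apply/prodf_neq0 => i _; rewrite qE mulf_neq0 // expf_neq0 //.
  exact: shifted_root_neq0.
under eq_bigr do rewrite qE.
have pu0 : \prod_i (lift (reversal q)).[(xi i)^-1] != 0 by apply/prodf_neq0.
have pxi0 : \prod_i xi i != 0 by apply/prodf_neq0 => i _; exact: shifted_root_neq0.
rewrite big_split /= prodrXl ordM ?expf_neq0 // ordX //.
have := ord_prod_eisenstein s_size s0 u_inj reversal_eisenstein_root r0 rd.
have := congr1 (@ord F) (prod_eisenstein_roots s_size s0 u_inj reversal_eisenstein_root).
rewrite prodfV ordV // ordM ?signr_eq0 ?lX_neq0 // (ord_eq (lX_order F)).
have -> : ord ((-1) ^+ d : K) = 0.
  by rewrite ordX ?oppr_eq0 ?oner_neq0 // ordN ord1 mul0rn.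
by rewrite add0r => /oppr_inj ->; rewrite -mulr_natl mulr1 natz gerDl.
Qed.

End RootNorm.

(** * Residue duality *)

Section Annihilator.
Variables (F : finFieldType) (N : nat) (S : set 'rV[F]_N).
Hypotheses (S0 : S 0) (SD : forall u v, S u -> S v -> S (u + v)).
Hypothesis SZ : forall c v, S v -> S (c *: v).

(** Over a finite field [S] has finitely many elements, so it is the row space of a matrix [A].
    Properness makes the cokernel of [A] nonzero, and any nonzero column of it annihilates [S]. *)
Lemma proper_subspace_annihilator z : ~ S z ->
  exists L : 'cV[F]_N, L != 0 /\ forall v, S v -> v *m L = 0.
Proof.
move=> zS; pose A := (\sum_(v : 'rV[F]_N | `[< S v >]) <<v>>)%MS.
have SA v : S v -> (v <= A)%MS.
  move=> Sv; apply: submx_trans (sumsmx_sup v _ (submx_refl _)); last exact/asboolP.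
  by rewrite genmxE.
have AS v : (v <= A)%MS -> S v.
  case/sub_sumsmxP=> u ->; elim/big_ind: _ => // i /asboolP Si.
  have : (u i *m <<i>> <= i)%MS by have := submxMl (u i) <<i>>%MS; rewrite genmxE.
  by case/sub_rVP=> c ->; apply: SZ.
have /eqP/matrixP C0 : cokermx A != 0.
  by apply: contra_notN zS; rewrite cokermx_eq0 => fA; apply/AS/submx_full.
have [k Ck0] : exists k, col k (cokermx A) != 0.
  apply: contrapT => /forallNP H; apply: C0 => i k; rewrite mxE.
  have /negP := H k; rewrite negbK => /eqP/colP/(_ i).
  by rewrite !mxE.
exists (col k (cokermx A)); split => // v /SA; rewrite submxE => /eqP vA.
by rewrite colE mulmxA vA mul0mx.
Qed.

End Annihilator.

Section Residue.
Variable F : fieldType.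
Local Notation K := (laurent F).

Lemma lcoef_sum (I : Type) (r : seq I) (P : pred I) (E : I -> K) (i : int) :
  (\sum_(k <- r | P k) E k) i = \sum_(k <- r | P k) E k i.
Proof. by elim/big_rec2: _ => // k x y _ <-. Qed.

Variables (mu : K -> F) (w : int).
Hypothesis muD : forall f g, mu (f + g) = mu f + mu g.
Hypothesis muZ : forall c f, mu (lconst c * f) = c * mu f.
Hypothesis mu_small : forall f, lbound w f -> mu f = 0.

Lemma residue_coef_small i : i < 2 - w -> mu (monomial F (1 - i)) = 0.
Proof.
move=> iw; apply: mu_small; apply/(lbound_orderE _ (is_order_monomial _ _)); lia.
Qed.

Lemma residue_bounded : exists v, forall i, i < v -> mu (monomial F (1 - i)) = 0.
Proof. by exists (2 - w) => i; apply: residue_coef_small. Qed.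

(** The coefficient at index 1 of [g x^-k] is that of [g] at [1 - k], which forces it to be the
    value of [mu] at [x^-k]. These values vanish for [k >= w], so [g] is a Laurent series. *)
Lemma residue_representation : exists g : K,
  lbound (2 - w) g /\ forall f, (g * f) 1 = mu f.
Proof.
pose g := Laurent residue_bounded.
have gb : lbound (2 - w) g by move=> i; apply: residue_coef_small.
exists g; split => // f.
have [v0 fv0] := lbound_ex f.
pose v := Num.min v0 (w - 1).
have fv : lbound v f by apply: lbound_le fv0; rewrite ge_min lexx.
have vw : v <= w - 1 by rewrite ge_min lexx orbT.
have [n nE] : exists n : nat, n%:Z = w - 1 - v by exists (absz (w - 1 - v)%R); lia.
(* The terms of [f] at indices [v] to [w - 1], in decreasing order so as to match the product
   formula; [mu] does not see the rest. *)
pose t := \sum_(j < n.+1) lconst (f (v + (n - j)%N%:Z)) * monomial F (v + (n - j)%N%:Z).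
have tb : lbound w (f - t).
  move=> i iw; rewrite [LHS]/= /t lcoef_sum.
  under eq_bigr do rewrite coef_lconstM.
  have [iv|vi] := ltP i v.
    rewrite fv // big1 ?subr0 // => j _ /=.
    by rewrite [_ == _](_ : _ = false) ?mulr0 //; lia.
  have kn : (n - absz (i - v)%R < n.+1)%N by lia.
  rewrite (bigD1 (Ordinal kn)) //= big1 ?addr0; last first.
    move=> j /eqP jk; rewrite [_ == _](_ : _ = false) ?mulr0 //.
    apply/eqP => ij; apply: jk; apply: val_inj => /=.
    by have := ltn_ord j; lia.
  have -> : v + (n - (n - absz (i - v)%R))%N%:Z = i by lia.
  by rewrite eqxx mulr1 subrr.
have fE : f = t + (f - t) by rewrite addrC subrK.
rewrite [in RHS]fE muD (mu_small tb) addr0.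
have mu0 : mu 0 = 0 by apply: mu_small.
rewrite /t (big_morph mu muD mu0).
have -> : 1 = 2 - w + v + n%:Z by lia.
rewrite [LHS](lmul_coef_sum n gb fv); apply: eq_bigr => j _.
rewrite muZ mulrC /=; congr (_ * mu (monomial F _)).
by have := ltn_ord j; lia.
Qed.

End Residue.

Definition box (F : fieldType) (d : nat) (w : 'I_d -> int) : set 'cV[laurent F]_d :=
  [set y | forall j, lbound (w j) (y j 0)].

Section Boxes.
Variables (F : fieldType) (d : nat).
Local Notation K := (laurent F).
Implicit Types (w : 'I_d -> int) (l : 'I_d -> nat) (y : 'cV[K]_d).

Lemma boxD w y1 y2 : box w y1 -> box w y2 -> box w (y1 + y2).
Proof. by move=> b1 b2 j; rewrite mxE; apply: lboundD. Qed.

Lemma boxB w y1 y2 : box w y1 -> box w y2 -> box w (y1 - y2).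
Proof. by move=> b1 b2 j; rewrite !mxE; apply: lboundB. Qed.

Lemma lbound_lconstM v c (f : K) : lbound v f -> lbound v (lconst c * f).
Proof. by move=> fv i iv; rewrite coef_lconstM fv ?mulr0. Qed.

Lemma boxZ w c y : box w y -> box w (lconst c *: y).
Proof. by move=> b j; rewrite mxE; apply: lbound_lconstM. Qed.

(** The blocks of lengths [l j] are flattened through an enumeration of dependent pairs, so that
    linear algebra on row vectors over [F] applies. *)
Definition digits w l y : 'rV[F]_#|{: {j : 'I_d & 'I_(l j)}}| :=
  \row_s (let: existT j i := (enum_val s : {j : 'I_d & 'I_(l j)}) in y j 0 (w j + (i : nat)%:Z)).

Lemma digitsD w l y1 y2 : digits w l (y1 + y2) = digits w l y1 + digits w l y2.
Proof. by apply/rowP => s; rewrite !mxE; case: (enum_val s) => j i; rewrite mxE. Qed.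

Lemma digits0 w l : digits w l 0 = 0.
Proof. by apply/rowP => s; rewrite !mxE; case: (enum_val s) => j i; rewrite mxE. Qed.

Lemma digitsB w l y1 y2 : digits w l (y1 - y2) = digits w l y1 - digits w l y2.
Proof. by apply/rowP => s; rewrite !mxE; case: (enum_val s) => j i; rewrite !mxE. Qed.

Lemma digitsZ w l c y : digits w l (lconst c *: y) = c *: digits w l y.
Proof. by apply/rowP => s; rewrite !mxE; case: (enum_val s) => j i; rewrite mxE coef_lconstM. Qed.

Lemma digits_eq0 w l y : box w y ->
  digits w l y = 0 <-> box (fun j => w j + (l j)%:Z) y.
Proof.
move=> wy; split=> [y0 j i iw|ly].
  have [/wy//|wi] := ltP i (w j).
  have il : (absz (i - w j)%R < l j)%N by lia.
  pose s : {j : 'I_d & 'I_(l j)} := Tagged (fun j => 'I_(l j)) (Ordinal il).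
  have := congr1 (fun z : 'rV_ _ => z 0 (enum_rank s)) y0.
  by rewrite !mxE enum_rankK /= => <-; congr (y j 0 _); lia.
apply/rowP => s; rewrite !mxE; case: (enum_val s) => j i; apply: ly.
by rewrite ltrD2l ltz_nat.
Qed.

End Boxes.

Section Duality.
Variables (F : finFieldType) (d : nat).
Local Notation K := (laurent F).
Variables (X : set 'cV[K]_d) (w : 'I_d -> int) (l : 'I_d -> nat).
Hypotheses (X0 : X 0) (XD : forall g h, X g -> X h -> X (g + h)).
Hypothesis XZ : forall p h, X h -> X (lpoly p *: h).
Hypothesis cover : forall y : 'cV[K]_d, exists h, X h /\ box w (y - h).

Let XB g h : X g -> X h -> X (g - h).
Proof.
move=> Xg Xh; apply: XD => //.
by rewrite -scaleN1r -(rmorph1 (@lpoly F)) -rmorphN; apply: XZ.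
Qed.

(* A functional on the digits killing those of the lattice points extends to a
   functional on [K^d] killing [X]; it is the residue of the product with some
   dual lattice vector. *)
Lemma digits_surjective :
  (forall g, dual_lattice X g -> box (fun j => 2 - (w j + (l j)%:Z)) g -> g = 0) ->
  forall z, exists h, [/\ X h, box w h & digits w l h = z].
Proof.
move=> dual0 z.
pose S : set 'rV[F]_ _ := [set z | exists h, [/\ X h, box w h & digits w l h = z]].
apply: contrapT => zS.
have [||||L [L0 LS]] := @proper_subspace_annihilator F _ S _ _ _ z.
- exists 0; split=> //; first by move=> j; rewrite mxE.
  exact: digits0.
- move=> _ _ [g [Xg wg <-]] [h [Xh wh <-]]; exists (g + h).
  by rewrite digitsD; split; [apply: XD|apply: boxD|].
- move=> c _ [h [Xh wh <-]]; exists (lconst c *: h).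
  by rewrite digitsZ; split; [apply: XZ|apply: boxZ|].
- exact: zS.
(* [la0] is meant for vectors of the box; [la] extends it to [K^d] by first subtracting a lattice
   point that moves [y] into the box. *)
pose la0 y : F := (digits w l y *m L) 0 0.
have [sg sgP] := choice cover.
pose la (y : 'cV[K]_d) := la0 (y - sg y).
(* Independence of the choice: two such lattice points differ by a lattice point in the box, whose
   digits [L] kills. *)
have laE (y h : 'cV[K]_d) : X h -> box w (y - h) -> la y = la0 (y - h).
  move=> Xh yh; have [Xs ys] := sgP y.
  apply/eqP; rewrite -subr_eq0 /la /la0; apply/eqP.
  have hE : y - sg y - (y - h) = h - sg y by rewrite opprB addrC addrA subrK.
  have := LS (digits w l (h - sg y)).
  rewrite -hE digitsB mulmxBl => /(_ _)/matrixP/(_ 0 0); rewrite !mxE => -> //.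
  exists (h - sg y); rewrite -digitsB hE; split; [exact: XB| |by []].
  by rewrite -hE; apply: boxB.
have laX h : X h -> la h = 0.
  move=> Xh; rewrite (laE h h) // subrr; last by move=> j; rewrite mxE.
  by rewrite /la0 digits0 mul0mx mxE.
have law y : box w y -> la y = la0 y.
  by move=> wy; rewrite (laE y 0) ?subr0.
have laD (y1 y2 : 'cV[K]_d) : la (y1 + y2) = la y1 + la y2.
  have [[X1 b1] [X2 b2]] := (sgP y1, sgP y2).
  have E : y1 + y2 - (sg y1 + sg y2) = (y1 - sg y1) + (y2 - sg y2).
    by rewrite opprD addrACA.
  rewrite (laE _ (sg y1 + sg y2)) ?E; [|exact: XD|exact: boxD].
  by rewrite /la /la0 digitsD mulmxDl mxE.
have laZ c (y : 'cV[K]_d) : la (lconst c *: y) = c * la y.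
  have [X1 b1] := sgP y.
  rewrite (laE _ (lconst c *: sg y)) -?scalerBr; [|exact: XZ|exact: boxZ].
  by rewrite /la /la0 digitsZ -scalemxAl mxE.
have la0' : la 0 = 0 by apply: laX.
pose inj j (f : K) : 'cV[K]_d := f *: delta_mx j 0.
(* On the [j]-th axis [la] kills all series of order at least [w j + l j], since their digits are 0;
   so it is a residue against some series. *)
have /choice[g0 g0P] (j : 'I_d) : exists g : K,
    lbound (2 - (w j + (l j)%:Z)) g /\ forall f, (g * f) 1 = la (inj j f).
  apply: residue_representation => [f1 f2|c f|f fw].
  - by rewrite /inj scalerDl laD.
  - by rewrite /inj -scalerA laZ.
  have wf : box w (inj j f).
    move=> i; rewrite !mxE; case: eqP => [->|_]; last by rewrite mulr0.
    by rewrite mulr1; apply: lbound_le fw; lia.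
  rewrite law // /la0 (_ : digits _ _ _ = 0) ?mul0mx ?mxE //.
  apply/(digits_eq0 _ wf) => i; rewrite !mxE; case: eqP => [->|_]; last by rewrite mulr0.
  by rewrite mulr1.
pose g : 'cV[K]_d := \col_j g0 j.
have gla (y : 'cV[K]_d) : (\sum_j g j 0 * y j 0) 1 = la y.
  rewrite lcoef_sum.
  have -> : y = \sum_j inj j (y j 0).
    rewrite {1}[y]matrix_sum_delta; apply: eq_bigr => j _.
    by rewrite big_ord1.
  rewrite (big_morph la laD la0'); apply: eq_bigr => j _.
  rewrite mxE (g0P j).2 summxE; congr (la (inj j _)).
  rewrite (bigD1 j) //= !mxE !eqxx mulr1 big1 ?addr0 // => k kj.
  by rewrite !mxE eq_sym (negPf kj) mulr0.
(* The coefficient at index [1 + k] of the pairing with [h] is the residue of its product with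
   [x^k], that is [la (x^k h) = 0]. *)
have gX : dual_lattice X g.
  move=> h Xh; apply/is_polyP => i i0.
  have -> : i = 1 + (absz (i - 1)%R)%:Z by lia.
  move: (absz _) => k; rewrite -[k%:Z]opprK -coef_monomialM -lX_monomial.
  rewrite mulr_sumr.
  have <- : la (lX F ^+ k *: h) = 0.
    by apply: laX; rewrite /lX -rmorphXn; apply: XZ.
  rewrite -gla; congr (lcoef _ 1); apply: eq_bigr => j _.
  by rewrite !mxE mulrCA.
have g_box : box (fun j => 2 - (w j + (l j)%:Z)) g.
  by move=> j; rewrite mxE; apply: (g0P j).1.
have g_0 := dual0 g gX g_box.
(* If [g = 0] then [la = 0], but its value on the monomial vector whose only digit is at [s] is the
   entry [s] of [L]. *)
move/eqP: L0; apply; apply/colP => s; rewrite mxE.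
case si: (enum_val s) => [j i].
pose y := inj j (monomial F (w j + (i : nat)%:Z)).
have wy : box w y.
  move=> k; rewrite !mxE; case: eqP => [->|_]; last by rewrite mulr0.
  by rewrite mulr1; apply/(lbound_orderE _ (is_order_monomial _ _)); lia.
have : la y = 0 by rewrite -gla g_0 big1 // => k _; rewrite mxE mul0r.
rewrite law // /la0 (_ : digits w l y = delta_mx 0 s) -?rowE ?mxE //.
apply/rowP => s'; rewrite !mxE /=.
rewrite -(inj_eq enum_val_inj) si; case: (enum_val s') => j' i'; rewrite !mxE.
have [jj|jj] := eqVneq j' j; last first.
  rewrite mulr0 /=; case: eqP => // -[j'j _].
  by rewrite j'j eqxx in jj.
subst j'; rewrite eqxx mulr1 -tag_eqE /tag_eq /= eqxx tagged_asE.
by rewrite (inj_eq (addrI _)).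
Qed.


End Duality.

(** * Counting lattice points *)

Lemma finType_card_eq (Z : finType) : [set: Z] #= `I_#|Z|.
Proof.
have <- : range (@enum_val Z predT) = [set: Z].
  by apply/seteqP; split=> // x _; exists (enum_rank x); rewrite ?enum_rankK.
have := @inj_card_eq _ _ [set: 'I_#|Z|] (@enum_val Z predT).
move=> /(_ (in2W enum_val_inj)) H; apply: card_eq_trans H _.
by rewrite card_eq_sym card_II.
Qed.

Lemma range_card_eq (Z : finType) (U : Type) (f : Z -> U) : injective f ->
  range f #= `I_#|Z|.
Proof.
move=> f_inj; apply: card_eq_trans (finType_card_eq Z).
by apply: inj_card_eq => x y _ _; apply: f_inj.
Qed.

(** * Rounding vectors of series to vectors of polynomials *)

Section PolynomialVectors.
Variables (F : fieldType) (d : nat).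
Local Notation A := {poly F}.
Local Notation K := (laurent F).
Local Notation lp := (map_mx (@lpoly F)).
Implicit Types (y e : 'cV[K]_d) (p a : 'cV[A]_d).

Lemma poly_vectorsP y : poly_vectors y <-> exists p, y = lp p.
Proof.
split=> [yP|[p ->] j]; last by exists (p j 0); rewrite ?mxE.
have /choice[p pP] (j : 'I_d) : exists p : A, lpoly p = y j 0.
  by have [p _ <-] := yP j; exists p.
by exists (\col_j p j); apply/colP => j; rewrite !mxE pP.
Qed.

Lemma lp_inj : injective (fun p => lp p).
Proof.
move=> p q /colP pq; apply/colP => j; apply: lpoly_inj.
by have := pq j; rewrite !mxE.
Qed.

Definition mxfloor y : 'cV[A]_d := \col_j lfloor (y j 0).

Lemma mxfloorP y : box (fun=> 1) (y - lp (mxfloor y)).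
Proof. by move=> j; rewrite !mxE; apply: lfloorP. Qed.

Lemma mxfloor_eq p e : box (fun=> 1) e -> mxfloor (lp p - e) = p.
Proof.
move=> e1; apply/colP => j; rewrite !mxE; apply: lfloor_eq.
rewrite addrAC subrr add0r; exact/lboundN.
Qed.

Lemma box_integral (M : 'M[K]_d) y : (forall i j, lbound 0 (M i j)) ->
  box (fun=> 1) y -> box (fun=> 1) (M *m y).
Proof.
move=> M0 y1 j; rewrite mxE; apply: lbound_sum => i _.
by rewrite -[1]add0r; apply: lboundM.
Qed.

Lemma lbound0_prod (I : Type) (r : seq I) (P : pred I) (E : I -> K) :
  (forall i, P i -> lbound 0 (E i)) -> lbound 0 (\prod_(i <- r | P i) E i).
Proof.
move=> E0; elim/big_ind: _ => //; first by move=> i /lt_eqF /= ->.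
by move=> f g f0 g0; rewrite -[0]addr0; apply: lboundM.
Qed.

Lemma lbound0_sign (s : nat) : lbound 0 ((-1) ^+ s : K).
Proof.
rewrite -signr_odd; case: (odd s) => /=; last by move=> i /lt_eqF /= ->.
by rewrite expr1; apply: lboundN => i /lt_eqF /= ->.
Qed.

Lemma lbound0_det (m : nat) (M : 'M[K]_m) : (forall i j, lbound 0 (M i j)) ->
  lbound 0 (\det M).
Proof.
move=> M0; apply: lbound_sum => s _; rewrite -[0]addr0.
by apply: lboundM; [apply: lbound0_sign|apply: lbound0_prod].
Qed.

Lemma lbound0_adj (M : 'M[K]_d) i j : (forall i j, lbound 0 (M i j)) ->
  lbound 0 (\adj M i j).
Proof.
move=> M0; rewrite mxE -[0]addr0; apply: lboundM; first exact: lbound0_sign.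
by apply: lbound0_det => i' j'; rewrite !mxE.
Qed.

(** The first rounding makes an error of negative degree; the integral matrix [N] keeps its degree
    negative, so the second rounding removes it. *)
Lemma mxfloor_integralK (M N : 'M[K]_d) a : (forall i j, lbound 0 (N i j)) ->
  N *m M = 1%:M -> mxfloor (N *m lp (mxfloor (M *m lp a))) = a.
Proof.
move=> N0 NM.
have -> : N *m lp (mxfloor (M *m lp a)) =
    lp a - N *m (M *m lp a - lp (mxfloor (M *m lp a))).
  by rewrite mulmxBr mulmxA NM mul1mx subKr.
by apply/mxfloor_eq/box_integral => //; apply: mxfloorP.
Qed.

Section Unitriangular.
Variable M : 'M[K]_d.
Hypotheses (M_trig : is_trig_mx M) (M_diag : forall j, M j j = 1).

(** The polynomial [p j] leaves the integral part and what remains involves only earlier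
    coordinates, so the map is inverted by forward substitution. *)
Lemma mxfloor_trigE p j : mxfloor (M *m lp p) j 0 =
  p j 0 + lfloor (\sum_(i < d | (i < j)%N) M j i * lpoly (p i 0)).
Proof.
rewrite mxE -lfloorDl; congr lfloor; rewrite mxE (bigD1 j) //= M_diag mul1r mxE.
congr (_ + _); rewrite [LHS]big_mkcond [RHS]big_mkcond; apply: eq_bigr => i _.
rewrite mxE; case: ltngtP => [ij|ji|/val_inj ->]; last by rewrite eqxx.
- by rewrite ifT //; apply: contraTneq ij => ->; rewrite ltnn.
- by rewrite (is_trig_mxP M_trig) ?mul0r ?if_same.
Qed.

Lemma mxfloor_trig_inj : injective (fun p => mxfloor (M *m lp p)).
Proof.
move=> p q /= /colP pq; apply/colP => j.
have [m] := ubnP j; elim: m j => // m IH j; rewrite ltnS => jm.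
have := pq j; rewrite !mxfloor_trigE.
rewrite (eq_bigr (fun i => M j i * lpoly (q i 0))); first by move/addIr.
by move=> i ij; rewrite IH // (leq_trans ij).
Qed.

Lemma mxfloor_trig_surj q : exists p, mxfloor (M *m lp p) = q.
Proof.
suff /(_ d)[p pP] m : exists p, forall j : 'I_d, (j < m)%N ->
    mxfloor (M *m lp p) j 0 = q j 0.
  by exists p; apply/colP => j; apply: pP.
elim: m => [|m [p pP]]; first by exists 0.
have [dm|md] := leqP d m.
  by exists p => j _; apply: pP; apply: leq_trans dm.
pose k := Ordinal md.
(* Adding the defect [c] to coordinate [k] corrects that coordinate of the image and leaves the
   earlier ones unchanged. *)
pose c := q k 0 - mxfloor (M *m lp p) k 0.
exists (\col_j (p j 0 + (if j == k then c else 0))) => j.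
have E (i : 'I_d) : (i <= m)%N -> \sum_(i0 < d | (i0 < i)%N) M i i0 *
    lpoly ((\col_j (p j 0 + (if j == k then c else 0))) i0 0) =
    \sum_(i0 < d | (i0 < i)%N) M i i0 * lpoly (p i0 0).
  move=> im; apply: eq_bigr => i0 i0i; rewrite mxE ifF ?addr0 //.
  by apply/eqP => i0k; move: (leq_trans i0i im); rewrite i0k ltnn.
rewrite ltnS leq_eqVlt => /predU1P[jm|jm].
  have -> : j = k by apply: val_inj.
  rewrite mxfloor_trigE E // mxE eqxx /c mxfloor_trigE; ring.
rewrite mxfloor_trigE E ?(ltnW jm) // mxE ifF ?addr0 -?mxfloor_trigE ?pP //.
by apply/eqP => jk; move: jm; rewrite jk ltnn.
Qed.

End Unitriangular.

End PolynomialVectors.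

(** * Counting the lattice points in a box *)

Section LatticePointCount.
Variables (F : finFieldType) (d : nat).
Local Notation A := {poly F}.
Local Notation K := (laurent F).
Local Notation lp := (map_mx (@lpoly F)).
Variables (L Q : 'M[K]_d) (phi k : 'I_d -> nat).
Hypotheses (L_trig : is_trig_mx L) (L_diag : forall j, L j j != 0).
Hypotheses (Q_int : forall i j, lbound 0 (Q i j)) (Q_det : \det Q = 1).
Hypothesis L_phi : forall i j : 'I_d, (i <= j)%N -> lbound (- (phi j)%:Z) (L j i).
Hypothesis kE : forall j, (k j)%:Z = (phi j)%:Z + ord (L j j).

Local Notation T := (L *m Q).
Local Notation w := (fun j => 1 - (phi j)%:Z).
Local Notation Qi := (\adj Q).

Let QiQ : Qi *m Q = 1%:M.
Proof. by rewrite mul_adj_mx Q_det. Qed.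

Let QQi : Q *m Qi = 1%:M.
Proof. by rewrite mul_mx_adj Q_det. Qed.

Let Qi_int i j : lbound 0 (Qi i j).
Proof. exact: lbound0_adj. Qed.

(** Row [j] of [L] has degree at most [phi j]. Hence rounding errors multiplied by [L] stay in the
    box and do not affect membership in it. *)
Lemma box_trig e : box (fun=> 1) e -> box w (L *m e).
Proof.
move=> e1 j; rewrite mxE; apply: lbound_sum => i _.
have [ij|ji] := leqP i j; last by rewrite (is_trig_mxP L_trig) ?mul0r.
by rewrite addrC; apply: lboundM => //; apply: L_phi.
Qed.

Lemma trig_det_neq0 : \det L != 0.
Proof. by rewrite det_trig //; apply/prodf_neq0. Qed.

Lemma trig_lattice_unit : T \in unitmx.
Proof. by rewrite unitmxE det_mulmx Q_det mulr1 unitfE trig_det_neq0. Qed.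

(** Round the coordinates of [y] in the basis [T]: [Q] keeps the error of negative degree and [L]
    sends it into the box. *)
Lemma lattice_cover y : exists h, lattice_of T h /\ box w (y - h).
Proof.
pose a := mxfloor (invmx T *m y).
exists (T *m lp a); split; first by exists (lp a) => //; apply/poly_vectorsP; exists a.
rewrite -[y in y - _](mulKVmx trig_lattice_unit) -mulmxBr -mulmxA.
by apply/box_trig/box_integral => //; apply: mxfloorP.
Qed.

Let M : 'M[K]_d := \matrix_(i, j) ((L i i)^-1 * L i j).

Let M_trig : is_trig_mx M.
Proof. by apply/is_trig_mxP => i j ij; rewrite mxE (is_trig_mxP L_trig i j) ?mulr0. Qed.

Let M_diag j : M j j = 1.
Proof. by rewrite mxE mulVf. Qed.

(** A nonlinear bijection of [A^d], in whose coordinates the box becomes a product of degree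
    conditions. *)
Let Psi (a : 'cV[A]_d) := mxfloor (M *m lp (mxfloor (Q *m lp a))).

Let Psi_inj : injective Psi.
Proof.
move=> a b /(mxfloor_trig_inj M_trig M_diag) ab.
rewrite -(mxfloor_integralK a Qi_int QiQ) ab.
exact: (mxfloor_integralK b Qi_int QiQ).
Qed.

Let Psi_surj q : exists a, Psi a = q.
Proof.
have [p <-] := mxfloor_trig_surj M_trig M_diag q.
exists (mxfloor (Qi *m lp p)); congr (mxfloor (M *m lp _)).
exact: (mxfloor_integralK p Q_int QQi).
Qed.

Let box_Psi a : box w (T *m lp a) <-> forall j, (size (Psi a j 0%R) <= k j)%N.
Proof.
set p := mxfloor (Q *m lp a).
have TE : T *m lp a = L *m lp p + L *m (Q *m lp a - lp p).
  by rewrite -mulmxDr addrC subrK mulmxA.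
have eP : box w (L *m (Q *m lp a - lp p)) by apply/box_trig/mxfloorP.
have -> : box w (T *m lp a) <-> box w (L *m lp p).
  rewrite TE; split=> [H|H]; last exact: boxD.
  by rewrite -[L *m lp p](addrK (L *m (Q *m lp a - lp p))); apply: boxB.
have LM j : (L *m lp p) j 0 = L j j * (M *m lp p) j 0.
  rewrite !mxE mulr_sumr; apply: eq_bigr => i _.
  by rewrite [M j i]mxE !mulrA divff ?mul1r.
have step j : lbound (w j) ((L *m lp p) j 0) <-> (size (Psi a j 0%R) <= k j)%N.
  rewrite LM lbound_mull // -(lbound_lpoly (Psi a j 0) (k j)).
  have -> : 1 - (phi j)%:Z - ord (L j j) = 1 - (k j)%:Z by rewrite kE; ring.
  set y := (M *m lp p) j 0.
  have -> : Psi a j 0 = lfloor y by rewrite mxE.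
  (* Since [k j] is a natural number, the fractional part always meets the bound, which therefore
     concerns only the integral part. *)
  have small : lbound (1 - (k j)%:Z) (y - lpoly (lfloor y)).
    by apply: lbound_le (lfloorP y); lia.
  split=> H.
    by rewrite -[lpoly _](subKr y); apply: lboundB.
  by rewrite -[y](subrK (lpoly (lfloor y))); apply: lboundD.
by split=> H j; apply/step.
Qed.

(** Through [Psi] the points correspond to families of polynomials of size at most [k j], encoded by
    functions on the pairs of a coordinate and a coefficient index. *)
Lemma lattice_box_card :
  [set h | lattice_of T h /\ box w h] #= `I_(#|F| ^ (\sum_j k j)).
Proof.
pose Z := {ffun {j : 'I_d & 'I_(k j)} -> F}.
have -> : (#|F| ^ (\sum_j k j))%N = #|{: Z}|.
  rewrite card_ffun card_tagged sumnE big_map big_enum /=.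
  by congr (_ ^ _)%N; apply: eq_bigr => j _; rewrite card_ord.
pose coefz (z : Z) j i : F :=
  if insub i is Some i' then z (Tagged (fun j => 'I_(k j)) (i' : 'I_(k j))) else 0.
pose q (z : Z) : 'cV[A]_d := \col_j \poly_(i < k j) coefz z j i.
have qE z s : (q z (tag s) 0)`_(tagged s : 'I_(k (tag s))) = z s.
  rewrite mxE coef_poly ltn_ord /coefz; case: insubP => [i' _ /val_inj ->|].
    by case: s {i'}.
  by rewrite ltn_ord.
have q_inj : injective q.
  by move=> z z' zz; apply/ffunP => s; rewrite -!qE zz.
have [Phi PhiK] := choice Psi_surj.
pose f z := T *m lp (Phi (q z)).
have f_inj : injective f.
  move=> z z' /(can_inj (mulKmx trig_lattice_unit))/lp_inj/(congr1 Psi).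
  by rewrite !PhiK => /q_inj.
suff -> : [set h | lattice_of T h /\ box w h] = range f by apply: range_card_eq.
apply/seteqP; split=> [h [[_ /poly_vectorsP[a ->] <-] /box_Psi ha]|_ [z _ <-]].
  pose z : Z := [ffun s : {j : 'I_d & 'I_(k j)} => (Psi a (tag s) 0)`_(tagged s : 'I_(k (tag s)))].
  exists z => //; rewrite /f; congr (_ *m lp _); apply: Psi_inj; rewrite PhiK.
  apply/colP => j; apply/polyP => i; have [ij|ji] := ltnP i (k j).
    have := qE z (Tagged (fun j => 'I_(k j)) (Ordinal ij)).
    by rewrite ffunE.
  by rewrite mxE coef_poly ltnNge ji /= nth_default // (leq_trans (ha j)).
split; first by exists (lp (Phi (q z))) => //; apply/poly_vectorsP; eexists.
by apply/box_Psi => j; rewrite PhiK mxE size_poly.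
Qed.

End LatticePointCount.

Lemma finite_set_enum (T : choiceType) (S : set T) : finite_set S ->
  exists (c : nat) (g : 'I_c -> T), injective g /\ range g = S.
Proof.
move=> /finite_seqP[s ->].
exists (size (undup s)), (tnth (in_tuple (undup s))); split.
  by apply/tuple_uniqP; apply: undup_uniq.
apply/seteqP; split=> [_ [i _ <-]|x /=].
  by have := mem_tnth i (in_tuple (undup s)); rewrite mem_undup.
rewrite -mem_undup => xs; have [i ->] := (tnthP (in_tuple (undup s)) x xs).
by exists i.
Qed.

(** A section of [D] identifies [Y] with the product of [Z] and the kernel, which gives the size of
    the kernel; every fiber is a translate of it. *)
Lemma additive_fiber_card (V : zmodType) (Z : finZmodType) (Y : set V)
    (D : V -> Z) (q m N : nat) :
  (1 < q)%N -> #|{: Z}| = (q ^ N)%N -> (N <= m)%N -> Y #= `I_(q ^ m) ->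
  (forall y1 y2, Y y1 -> Y y2 -> Y (y1 + y2)) ->
  (forall y1 y2, Y y1 -> Y y2 -> Y (y1 - y2)) ->
  (forall y1 y2, D (y1 + y2) = D y1 + D y2) ->
  (forall y1 y2, D (y1 - y2) = D y1 - D y2) ->
  (forall z, exists y, Y y /\ D y = z) ->
  forall z, [set y | Y y /\ D y = z] #= `I_(q ^ (m - N)).
Proof.
move=> q1 cZ Nm cY YD YB DD DB surj.
have ker_fin : finite_set [set y | Y y /\ D y = 0].
  apply: (@sub_finite_set _ _ Y) => [y []//|].
  by apply/finite_setP; exists (q ^ m)%N.
have [c [g [g_inj gE]]] := finite_set_enum ker_fin.
have gP i : Y (g i) /\ D (g i) = 0.
  by have : [set y | Y y /\ D y = 0] (g i) by rewrite -gE; exists i.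
have gS y : Y y -> D y = 0 -> exists i, g i = y.
  by move=> Yy Dy; have : range g y; [rewrite gE|case=> i _ <-; exists i].
have [s sP] := choice surj.
pose f (zi : Z * 'I_c) := s zi.1 + g zi.2.
have f_inj : injective f.
  move=> [z1 i1] [z2 i2]; rewrite /f /= => e.
  have z12 : z1 = z2.
    have := congr1 D e; rewrite !DD (sP z1).2 (sP z2).2.
    by rewrite (gP i1).2 (gP i2).2 !addr0.
  by move: e; rewrite z12 => /addrI/g_inj ->.
have fE : range f = Y.
  apply/seteqP; split=> [_ [[z i] _ <-]|y Yy].
    by apply: YD; [exact: (sP z).1|exact: (gP i).1].
  have [||i gi] := gS (y - s (D y)).
  - by apply: YB => //; exact: (sP _).1.
  - by rewrite DB (sP _).2 subrr.
  by exists (D y, i) => //; rewrite /f /= gi addrC subrK.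
have cE : c = (q ^ (m - N))%N.
  have := range_card_eq f_inj; rewrite fE card_prod card_ord cZ => cY'.
  have := card_eq_trans (etrans (card_eq_sym _ _) cY') cY.
  move=> /card_eq_II/eqP; rewrite -[X in _ == (_ ^ X)%N](subnKC Nm) expnD.
  by rewrite eqn_pmul2l ?expn_gt0 ?(ltnW q1) // => /eqP.
move=> z; have h_inj : injective (fun i => s z + g i) by move=> i j /addrI/g_inj.
have := range_card_eq h_inj; rewrite card_ord -cE.
congr (_ #= _); apply/seteqP; split=> [_ [i _ <-]|y [Yy Dy]].
  split; first by apply: YD; [exact: (sP z).1|exact: (gP i).1].
  by rewrite DD (sP z).2 (gP i).2 addr0.
have [||i gi] := gS (y - s z).
- by apply: YB => //; exact: (sP _).1.
- by rewrite DB (sP _).2 Dy subrr.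
by exists i => //; rewrite gi addrC subrK.
Qed.

(** * The Vandermonde determinant *)

Section SmallPolynomials.
Variables (F : finFieldType) (n : nat).
Local Notation A := {poly F}.
Local Notation K := (laurent F).
Local Notation lift := (map_poly (@lpoly F)).
Local Notation q := #|F|.
Local Notation V := {ffun 'I_n -> F}.

Definition vpoly (a : V) : A := \sum_(i < n) a i *: 'X^i.

Lemma coef_vpoly a (i : 'I_n) : (vpoly a)`_i = a i.
Proof.
rewrite coef_sum (bigD1 i) //= coefZ coefXn eqxx mulr1 big1 ?addr0 // => j ji.
rewrite coefZ coefXn [_ == _](_ : _ = false) ?mulr0 //.
by apply: contraNF ji => /eqP ij; apply/eqP/val_inj.
Qed.

Lemma size_vpoly a : (size (vpoly a) <= n)%N.
Proof.
apply: leq_trans (size_sum _ _ _) _; apply/bigmax_leqP => i _.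
by apply: leq_trans (size_scale_leq _ _) _; rewrite size_polyXn.
Qed.

Lemma vpolyD a c : vpoly (a + c) = vpoly a + vpoly c.
Proof. by rewrite /vpoly -big_split; apply: eq_bigr => i _; rewrite ffunE scalerDl. Qed.

Lemma vpoly_inj : injective vpoly.
Proof. by move=> a c ac; apply/ffunP => i; rewrite -!coef_vpoly ac. Qed.

Lemma vpoly0 : vpoly 0 = 0.
Proof. by rewrite /vpoly big1 // => i _; rewrite ffunE scale0r. Qed.

Lemma card_vpoly_size (k : nat) : (k <= n)%N ->
  #|[pred a | (size (vpoly a) <= k)%N]| = (q ^ k)%N.
Proof.
move=> kn; have cD : #|[pred i : 'I_n | (i < k)%N]| = k.
  by rewrite -sum1_card (big_ord_narrow kn) sum1_card card_ord.
rewrite -[in RHS]cD -(card_pffun_on 0 _ F).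
apply: eq_card => a; rewrite inE; apply/idP/pffun_onP => [ak|[/fintype.subsetP aD _]].
  split=> //; apply/fintype.subsetP => i; rewrite !inE; apply: contraR.
  by rewrite -leqNgt -coef_vpoly => ki; rewrite nth_default // (leq_trans ak).
apply/leq_sizeP => j kj; have [jn|nj] := ltnP j n; last first.
  by rewrite nth_default // (leq_trans (size_vpoly a)).
rewrite (coef_vpoly a (Ordinal jn)); apply/eqP/negPn/negP => /aD.
by rewrite inE /= ltnNge kj.
Qed.

(** Write each degree as the number of [k >= 1] below the size, exchange the sums, and count the
    polynomials of size greater than [k]. The zero polynomial contributes 0. *)
Lemma sum_deg_vpoly :
  (\sum_a (size (vpoly a)).-1 = \sum_(1 <= k < n) (q ^ n - q ^ k))%N.
Proof.
have E a : (size (vpoly a)).-1 = (\sum_(1 <= k < n) (k < size (vpoly a)))%N.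
  have := size_vpoly a; move: (size _) => s; case: n => [|m] sm.
    by rewrite big_geq //; case: s sm.
  rewrite big_add1 /= big_mkord (eq_bigr (fun i : 'I_m => if (i < s.-1)%N then 1%N else 0%N)).
    have sm' : (s.-1 <= m)%N by case: s sm.
    by rewrite -big_mkcond /= (big_ord_narrow sm') sum1_card card_ord.
  by move=> i _; rewrite -ltn_predRL; case: ltnP.
rewrite (eq_bigr _ (fun a _ => E a)) exchange_big /= big_nat [RHS]big_nat.
apply: eq_bigr => k /andP[k1 kn].
have <- : #|{: V}| = (q ^ n)%N by rewrite card_ffun card_ord.
rewrite -(card_vpoly_size (ltnW kn)) -(cardC [pred a | (size (vpoly a) <= k)%N]) addKn.
rewrite -sum1_card [RHS]big_mkcond; apply: eq_bigr => a _.
by rewrite !inE -ltnNge; case: ltnP.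
Qed.

Definition vprod : {poly A} := \prod_(a : V) ('X - (vpoly a)%:P).

Lemma vprod_monic : vprod \is monic.
Proof. exact: monic_prod_XsubC. Qed.

Lemma size_vprod : size vprod = (q ^ n).+1.
Proof. by rewrite /vprod -big_enum size_prod_XsubC -cardE card_ffun card_ord. Qed.

Lemma vprod_coef0 : vprod`_0 = 0.
Proof.
rewrite -horner_coef0 horner_prod (bigD1 (0 : V)) //= hornerXsubC vpoly0.
by rewrite subrr mul0r.
Qed.

Lemma lift_vprod : lift vprod = \prod_(a : V) ('X - (lpoly (vpoly a))%:P).
Proof.
by rewrite rmorph_prod; apply: eq_bigr => a _; rewrite rmorphB /= map_polyX map_polyC.
Qed.

(** Translation by [vpoly a] permutes the factors, as the [vpoly] form an additive group. *)
Lemma horner_vprodD z a : (lift vprod).[z + lpoly (vpoly a)] = (lift vprod).[z].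
Proof.
rewrite lift_vprod !horner_prod (reindex_inj (addIr a)).
by apply: eq_bigr => c _; rewrite !hornerXsubC vpolyD rmorphD /= opprD addrACA subrr addr0.
Qed.

Variables (d : nat) (xi : 'I_d -> K).
Hypotheses (dE : d = (q ^ n)%N) (xi_inj : injective xi).
Hypothesis xi_root : forall z, (lift vprod).[z] = - (lX F)^-1 <-> exists i, xi i = z.

(** By translation invariance and the count [d = q^n], the roots form the coset of [xi i] modulo the
    polynomials of degree less than [n]; the differences are the nonzero ones, with order minus
    their degree. *)
Lemma sum_ord_differences i : \sum_(j | j != i) ord (xi j - xi i) =
  - (\sum_(1 <= k < n) (q ^ n - q ^ k))%N%:Z.
Proof.
have /choice[tau tauP] (a : V) : exists j, xi j = xi i + lpoly (vpoly a).
  by apply/xi_root; rewrite horner_vprodD; apply/xi_root; exists i.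
have tau_inj : injective tau.
  by move=> a c ac; apply/vpoly_inj/lpoly_inj/(addrI (xi i)); rewrite -!tauP ac.
have tau_bij : bijective tau.
  by apply: inj_card_bij => //; rewrite card_ord card_ffun card_ord dE.
rewrite (reindex tau) /=; last exact: onW_bij.
have -> : (\sum_(1 <= k < n) (q ^ n - q ^ k) = \sum_(a : V | a != 0%R) (size (vpoly a)).-1)%N.
  by rewrite -sum_deg_vpoly (bigD1 (0 : V)) //= vpoly0 size_poly0.
have tau0 : tau 0 = i by apply: xi_inj; rewrite tauP vpoly0 rmorph0 addr0.
rewrite -natz natr_sum -sumrN.
apply: eq_big => [a|a ai]; first by rewrite -{1}tau0 (inj_eq tau_inj).
have a0 : vpoly a != 0.
  by apply: contraNneq ai => a0; rewrite -tau0 (inj_eq tau_inj) -(inj_eq vpoly_inj) a0 vpoly0.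
rewrite tauP addrAC subrr add0r ord_lpoly // natz.
by move: a0; rewrite -size_poly_gt0; case: (size _) => //= m _; lia.
Qed.

Lemma power_mx_det_neq0 : \det (\matrix_(i, j) xi i ^+ j : 'M[K]_d) != 0.
Proof.
have -> : (\matrix_(i, j) xi i ^+ j : 'M[K]_d) = (Vandermonde d (\row_j xi j))^T.
  by apply/matrixP => i j; rewrite !mxE.
by rewrite det_tr det_Vandermonde_neq0 // => i j; rewrite !mxE => /xi_inj.
Qed.

(** The Vandermonde product runs over [i < j]. Doubling its order gives a sum over all ordered pairs
    of distinct indices, as [ord] ignores signs, and then each row contributes the same amount. *)
Lemma ord_det_power_mx : ord (\det (\matrix_(i, j) xi i ^+ j : 'M[K]_d)) *+ 2 =
  - (d * \sum_(1 <= k < n) (q ^ n - q ^ k))%N%:Z.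
Proof.
have -> : (\matrix_(i, j) xi i ^+ j : 'M[K]_d) = (Vandermonde d (\row_j xi j))^T.
  by apply/matrixP => i j; rewrite !mxE.
have d0 (i j : 'I_d) : i != j -> xi j - xi i != 0.
  by rewrite subr_eq0 (inj_eq xi_inj) eq_sym.
rewrite det_tr det_Vandermonde ord_prod; last first.
  move=> i _; apply/prodf_neq0 => j ij; rewrite !mxE d0 //.
  by apply: contraTneq ij => ->; rewrite ltnn.
transitivity (\sum_(i < d) \sum_(j < d | (i < j)%N) ord (xi j - xi i) +
  \sum_(i < d) \sum_(j < d | (j < i)%N) ord (xi j - xi i)).
  rewrite mulr2n; congr (_ + _).
    apply: eq_bigr => i _; rewrite ord_prod => [|j ij]; last first.
      by rewrite !mxE d0 //; apply: contraTneq ij => ->; rewrite ltnn.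
    by apply: eq_bigr => j _; rewrite !mxE.
  rewrite [RHS](exchange_big_dep xpredT) //=; apply: eq_bigr => i _.
  rewrite ord_prod => [|j ij]; last first.
    by rewrite !mxE d0 //; apply: contraTneq ij => ->; rewrite ltnn.
  by apply: eq_bigr => j _; rewrite !mxE -ordN opprB.
rewrite -big_split /= (eq_bigr (fun=> - (\sum_(1 <= k < n) (q ^ n - q ^ k))%N%:Z)).
  by rewrite sumr_const card_ord mulNrn PoszM -mulr_natl natz.
move=> i _; rewrite -(sum_ord_differences i) [RHS](bigID (fun j : 'I_d => (i < j)%N)) /=.
congr (_ + _); apply: eq_bigl => j.
  by rewrite -val_eqE /=; case: ltngtP.
by rewrite -val_eqE /=; case: ltngtP.
Qed.

End SmallPolynomials.

(** * The net *)

Lemma geometric_sum (b n : nat) : (0 < b)%N -> (1 <= n)%N ->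
  ((b - 1) * \sum_(1 <= k < n) b ^ k = b ^ n - b)%N.
Proof.
move=> b0; case: n => // n _.
elim: n => [|n IH]; first by rewrite big_geq // muln0 expn1 subnn.
rewrite big_nat_recr //= mulnDr IH mulnBl mul1n -expnS.
have : (b ^ 1 <= b ^ n.+1)%N by rewrite leq_pexp2l.
have : (b ^ n.+1 <= b ^ n.+2)%N by rewrite leq_pexp2l.
rewrite expn1; lia.
Qed.

(** The logarithm is [n], and the geometric sum gives, with [d = b^n], the identity [(n-1) d -
    (d-b)/(b-1) = n d - (d-1) b/(b-1)]. *)
Lemma quality_boundE (R : realType) (b n D : nat) : (1 < b)%N -> (1 <= n)%N ->
  (2 * D = b ^ n * \sum_(1 <= k < n) (b ^ n - b ^ k))%N ->
  quality_bound b R (b ^ n) = D%:R.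
Proof.
move=> b1 n1 DE; rewrite /quality_bound natrX.
have b0 : (0 : R) < b%:R by rewrite ltr0n (ltn_trans _ b1).
have lnb : ln (b%:R : R) != 0 by rewrite gt_eqF // ln_gt0 // ltr1n.
have -> : ln (b%:R ^+ n : R) / ln b%:R = n%:R.
  by rewrite lnXn // -[ln _ *+ n]mulr_natl mulfK.
have b10 : (b%:R : R) - 1 != 0 by rewrite subr_eq0 pnatr_eq1 gtn_eqF.
have gs : (b%:R - 1) * \sum_(1 <= k < n) b%:R ^+ k = b%:R ^+ n - b%:R :> R.
  have := congr1 (fun k : nat => k%:R : R) (geometric_sum (ltnW b1) n1).
  rewrite natrM !natrB ?(ltnW b1) //; last by rewrite -{1}(expn1 b) leq_pexp2l // ltnW.
  rewrite natr_sum natrX => <-; congr (_ * _).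
  by apply: eq_bigr => k _; rewrite natrX.
have {}DE : 2 * D%:R = b%:R ^+ n * (n.-1%:R * b%:R ^+ n - \sum_(1 <= k < n) b%:R ^+ k) :> R.
  rewrite -natrM DE natrM natrX natr_sum; congr (_ * _).
  rewrite mulr_natl -subn1 -sumr_const_nat -sumrB !big_nat.
  apply: eq_bigr => k /andP[_ kn].
  by rewrite natrB ?natrX // leq_pexp2l // ltnW.
have two : (2 : R) != 0 by rewrite pnatr_eq0.
apply: (mulfI two); rewrite DE; apply: (mulfI b10).
have -> : n%:R = n.-1%:R + 1 :> R by rewrite -{1}(prednK n1) -natr1.
have gs' : \sum_(1 <= k < n) b%:R ^+ k = (b%:R ^+ n - b%:R) / (b%:R - 1) :> R.
  by rewrite -gs mulrAC divff ?mul1r.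
rewrite gs'; field.
by rewrite b10.
Qed.

(** * The lattice attached to the roots of [pd] and its dual *)

Section ShiftedLattice.
Variables (b n d' : nat).
Local Notation F := 'F_b.
Local Notation K := (laurent F).
Local Notation d := d'.+1.
Local Notation lift := (map_poly (@lpoly F)).
Local Notation lp := (map_mx (@lpoly F)).
Hypotheses (b_prime : prime b) (dE : d = (b ^ n)%N).
Variable xi : 'I_d -> K.
Hypotheses (xi_inj : injective xi) (xi_roots : [set z | root (pd b n) z] = range xi).

Local Notation T := (lattice_mx xi).
Local Notation X := (lattice_of T).
Local Notation B := (power_mx xi).

Let cardF : #|F| = b.
Proof. by rewrite card_Fp. Qed.

Lemma pd_rootE z : root (pd b n) z <-> (lift (vprod F n)).[z] = - (lX F)^-1.
Proof.
have -> : pd b n = lift (vprod F n) + ((lX F)^-1)%:P by rewrite lift_vprod.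
rewrite rootE hornerD hornerC addr_eq0; split=> [/eqP|->] //.
Qed.

Lemma xi_rootP z : (lift (vprod F n)).[z] = - (lX F)^-1 <-> exists i, xi i = z.
Proof.
have -> : (exists i, xi i = z) <-> range xi z.
  by split=> [[i <-]|[i _ <-]]; exists i.
by rewrite -xi_roots -pd_rootE.
Qed.

Lemma power_mx_unit : B \in unitmx.
Proof. by rewrite unitmxE unitfE; apply: power_mx_det_neq0. Qed.

(** Pair [g] with the columns of [T], which are the rows of the inverse of [B]: the coordinates of
    [B^-1 g] are polynomials. *)
Lemma dual_latticeE g : dual_lattice X g -> exists a, g = B *m lp a.
Proof.
move=> gX; have /poly_vectorsP[a aE] : poly_vectors (invmx B *m g).
  move=> k; pose e : 'cV[K]_d := delta_mx k 0; have := gX (T *m e).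
  have -> : \sum_j g j 0 * (T *m e) j 0 = (invmx B *m g) k 0.
    by rewrite -colE mxE; apply: eq_bigr => j _; rewrite !mxE mulrC.
  apply; exists e => //; apply/poly_vectorsP.
  exists (delta_mx k 0); apply/matrixP => i j; rewrite !mxE.
  by case: (_ && _); rewrite ?rmorph0 ?rmorph1.
by exists a; rewrite -aE mulKVmx ?power_mx_unit.
Qed.

(** The coordinates of [g] are the values at the [xi i] of one polynomial [q] over A of size at most
    [d], so their product is a norm and [root_norm] applies. *)
Lemma dual_lattice_norm g : dual_lattice X g -> g != 0 ->
  (forall j, g j 0 != 0) /\ \sum_j ord (g j 0) <= d'%:Z.
Proof.
move=> /dual_latticeE[a ->] g0.
pose q : {poly {poly F}} := \poly_(j < d) a (inord j) 0.
have qE i : (B *m lp a) i 0 = (lift q).[xi i].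
  rewrite (@horner_coef_wide _ d); last first.
    by apply: leq_trans (size_poly _ _) (size_poly _ _).
  rewrite mxE; apply: eq_bigr => j _.
  by rewrite !mxE coef_map coef_poly ltn_ord inord_val mulrC.
have q0 : q != 0.
  apply: contraNneq g0 => q0; apply/eqP/colP => i.
  by rewrite qE q0 rmorph0 horner0 mxE.
have G_size : size (vprod F n) = d.+1 by rewrite size_vprod cardF -dE.
have xi_r i : (lift (vprod F n)).[xi i] = - (lX F)^-1 by apply/xi_rootP; exists i.
have [N0 ord_N] := root_norm (vprod_monic F n) G_size (vprod_coef0 F n) xi_inj xi_r q0
  (size_poly _ _).
have g_neq0 j : (B *m lp a) j 0 != 0.
  by rewrite qE; move/prodf_neq0: N0 => /(_ j isT).
split=> //; rewrite -ord_prod //.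
by under eq_bigr do rewrite qE.
Qed.

Lemma lattice_admissible (R : realType) : admissible R X.
Proof.
apply: (@lt_le_trans _ _ ((- d'%:R)%:E : \bar R)%E); first exact: ltNyr.
apply/ereal_infP => _ [g [gX /eqP g0] <-].
have [gj0 gN] := dual_lattice_norm gX g0.
rewrite (eq_bigr (fun j => ((- ord (g j 0))%:~R : R)%:E)); last first.
  by move=> j _; rewrite degE.
rewrite sumEFin lee_fin -(rmorph_sum (intmul 1)) sumrN rmorphN lerN2.
by rewrite -[d'%:R]/((d'%:Z)%:~R) ler_int.
Qed.

Lemma lattice0 : X 0.
Proof. by exists 0; rewrite ?mulmx0 // => j; exists 0; rewrite ?rmorph0 ?mxE. Qed.

Lemma latticeD g h : X g -> X h -> X (g + h).
Proof.
move=> [_ /poly_vectorsP[p ->] <-] [_ /poly_vectorsP[q ->] <-].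
exists (lp (p + q)); first by apply/poly_vectorsP; exists (p + q).
by rewrite map_mxD mulmxDr.
Qed.

Lemma latticeZ p h : X h -> X (lpoly p *: h).
Proof.
move=> [_ /poly_vectorsP[q ->] <-].
exists (lp (p *: q)); first by apply/poly_vectorsP; exists (p *: q).
by rewrite map_mxZ -scalemxAr.
Qed.

Lemma latticeB g h : X g -> X h -> X (g - h).
Proof.
move=> Xg Xh; apply: latticeD => //.
by rewrite -scaleN1r -(rmorph1 (@lpoly F)) -rmorphN; apply: latticeZ.
Qed.

(** * The net property of the scaled lattice *)

Section Net.
Variables (L Q : 'M[K]_d) (f : 'cV[K]_d) (phi : 'I_d -> nat) (D : nat).
Hypotheses (TLQ : T = L *m Q) (L_trig : is_trig_mx L).
Hypotheses (Q_int : forall i j, lbound 0 (Q i j)) (Q_det : \det Q = 1).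
Hypotheses (f0 : forall j, f j 0 != 0) (f_ord : forall j, ord (f j 0) = - (phi j)%:Z).
Hypothesis L_phi : forall i j : 'I_d, (i <= j)%N -> lbound (- (phi j)%:Z) (L j i).
Hypothesis DE : ord (\det B) = - D%:Z.

Local Notation w := (fun j => 1 - (phi j)%:Z).
Local Notation m := (D + \sum_j phi j)%N.
Local Notation Y := [set y | X y /\ box w y].

Let detL : \det L = (\det B)^-1.
Proof.
by rewrite -[LHS]mulr1 -Q_det -det_mulmx -TLQ det_tr det_inv.
Qed.

Let L_diag j : L j j != 0.
Proof.
have : \det L != 0 by rewrite detL invr_eq0 -unitfE -unitmxE power_mx_unit.
by rewrite det_trig // => /prodf_neq0; apply.
Qed.

Let k j := absz ((phi j)%:Z + ord (L j j)).

(** The diagonal case of [L_phi] makes the right side nonnegative, so the absolute value in [k] is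
    harmless. *)
Let kE j : (k j)%:Z = (phi j)%:Z + ord (L j j).
Proof.
have /(lbound_ordE _ (L_diag j)) := L_phi (leqnn j).
by rewrite /k; lia.
Qed.

(** The orders of the diagonal entries of [L] add up to that of [det L = (det B)^-1], which is
    [D]. *)
Lemma lattice_box_points : Y #= `I_(b ^ m).
Proof.
suff km : (\sum_j k j)%N = m.
  by have := lattice_box_card L_trig L_diag Q_int Q_det L_phi kE; rewrite -TLQ cardF km.
apply/eqP; rewrite -eqz_nat; apply/eqP.
rewrite PoszD !(big_morph Posz PoszD erefl) (eq_bigr _ (fun j _ => kE j)) big_split /=.
rewrite addrC; congr (_ + _).
rewrite -ord_prod // -det_trig // detL ordV ?DE ?opprK //.
by rewrite -unitfE -unitmxE power_mx_unit.
Qed.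

Lemma lattice_digits_surjective (l : 'I_d -> nat) :
  (\sum_j l j)%N = (\sum_j phi j)%N ->
  forall z, exists h, [/\ X h, box w h & digits w l h = z].
Proof.
move=> lphi; apply: digits_surjective.
- exact: lattice0.
- exact: latticeD.
- exact: latticeZ.
- by rewrite TLQ; apply: lattice_cover.
move=> g gX gb; apply/eqP/negPn/negP => g0.
have [gj0 gN] := dual_lattice_norm gX g0.
(* The dual box asks for order at least [2 - (1 - phi j + l j)] in coordinate [j]. These bounds add
   up to [d], while the norm allows only [d - 1]. *)
have : \sum_(j < d) (1 + (phi j)%:Z - (l j)%:Z) <= d'%:Z.
  apply: le_trans gN; apply: ler_sum => j _.
  by have /(lbound_ordE _ (gj0 j)) := gb j; lia.
rewrite sumrB big_split /= sumr_const card_ord.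
rewrite -!(big_morph Posz PoszD erefl) lphi.
by rewrite addrK -[1 *+ _]/(d%:R : int) natz lez_nat ltnn.
Qed.

Lemma lattice_digit_fiber (l : 'I_d -> nat) : (\sum_j l j)%N = (\sum_j phi j)%N ->
  forall z, [set y | Y y /\ digits w l y = z] #= `I_(b ^ D).
Proof.
move=> lphi z.
have cI : #|{: {j : 'I_d & 'I_(l j)}}| = (\sum_j phi j)%N.
  rewrite card_tagged sumnE big_map big_enum /= -lphi.
  by apply: eq_bigr => j _; rewrite card_ord.
have := @additive_fiber_card _ _ Y (digits w l) b m (\sum_j phi j) (prime_gt1 b_prime)
  _ (leq_addl _ _) lattice_box_points.
rewrite addnK; apply.
- by rewrite card_mx mul1n cI cardF.
- by move=> y1 y2 [X1 b1] [X2 b2]; split; [apply: latticeD|apply: boxD].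
- by move=> y1 y2 [X1 b1] [X2 b2]; split; [apply: latticeB|apply: boxB].
- exact: digitsD.
- exact: digitsB.
by move=> z'; have [h []] := lattice_digits_surjective lphi z'; exists h.
Qed.

Let scale (y : 'cV[K]_d) : 'cV[K]_d := \col_j ((f j 0)^-1 * y j 0).

Let scale_inj : injective scale.
Proof.
move=> y z /colP yz; apply/colP => j; apply: (@mulfI _ (f j 0)^-1).
  by rewrite invr_eq0.
by have := yz j; rewrite !mxE.
Qed.

Let lbound_scale v j (g : K) : lbound v ((f j 0)^-1 * g) <-> lbound (v - (phi j)%:Z) g.
Proof. by rewrite lbound_mull ?invr_eq0 // ordV // f_ord opprK. Qed.

Let unit_cubeP (g : 'cV[K]_d) : unit_cube g <-> forall j, lbound 1 (g j 0).
Proof.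
by split=> H j; [have /(deg_ltP _ 0) := H j|apply/(deg_ltP _ 0)]; rewrite subr0.
Qed.

Let box_scale y : box w y <-> unit_cube (scale y).
Proof.
rewrite unit_cubeP; split=> H j; first by rewrite mxE; apply/lbound_scale/H.
by apply/lbound_scale; have := H j; rewrite mxE.
Qed.

Lemma scaled_lattice_net : (1 <= m)%N ->
  is_net D m (scale_inv f X `&` unit_cube).
Proof.
move=> m1.
have PE : scale_inv f X `&` unit_cube = scale @` Y.
  apply/seteqP; split=> [_ [[y Xy <-] /box_scale yb]|_ [y [Xy yb] <-]].
    by exists y.
  by split; [exists y|apply/box_scale].
split=> //.
- by split=> //; apply: leq_addr.
- rewrite PE; apply: card_eq_trans lattice_box_points.
  by apply: inj_card_eq => x y _ _; apply: scale_inj.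
move=> l h; rewrite addKn => lphi hl.
have h1 j : lbound 1 (h j).
  have [c _ <-] := hl j; apply: lbound_sum => i _; apply: lbound_lconstM.
  apply/lbound_ordE; rewrite ?invr_eq0 ?expf_neq0 ?lX_neq0 //.
  rewrite ordV ?expf_neq0 ?lX_neq0 // ordX ?lX_neq0 // (ord_eq (lX_order F)).
  by rewrite mulNrn opprK -[1 *+ _]/(i.+1%:R : int) natz.
(* Multiplying by [f] turns the elementary cell around [h] into a condition on digits. [fh] need not
   lie in the lattice: only its digits matter, and every fiber has the same size. *)
pose fh : 'cV[K]_d := \col_j (f j 0 * h j).
have fhb : box w fh.
  by move=> j; apply/(lbound_scale 1); rewrite mxE mulKf.
have digitsE y : box w y ->
    digits w l y = digits w l fh <->
    forall j, (deg (scale y j 0 - h j)%R < (- (l j)%:Z)%:E)%E.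
  move=> yb; have := digits_eq0 l (boxB yb fhb); rewrite digitsB => E.
  have E' : digits w l y - digits w l fh = 0 <-> digits w l y = digits w l fh.
    by split=> [/eqP|->]; rewrite ?subrr // subr_eq0 => /eqP.
  rewrite -E' E.
  have step j : lbound (w j + (l j)%:Z) ((y - fh) j 0) <->
      (deg (scale y j 0 - h j)%R < (- (l j)%:Z)%:E)%E.
    rewrite deg_ltP.
    have -> : scale y j 0 - h j = (f j 0)^-1 * ((y - fh) j 0).
      by rewrite !mxE mulrBr mulKf.
    by rewrite lbound_scale; have -> : 1 - - (l j)%:Z - (phi j)%:Z = w j + (l j)%:Z by lia.
  by split=> H j; apply/step.
have -> : [set g | [/\ (scale_inv f X `&` unit_cube) g, unit_cube g &
    forall j, (deg (g j 0 - h j)%R < (- (l j)%:Z)%:E)%E]] =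
    scale @` [set y | Y y /\ digits w l y = digits w l fh].
  apply/seteqP; split=> [g [+ _ gh]|_ [y [[Xy yb] yd] <-]].
    rewrite PE => -[y [Xy yb] yg]; exists y => //; split=> //.
    by apply/digitsE => // j; rewrite yg.
  have sy : unit_cube (scale y) by apply/box_scale.
  by split=> //; [split=> //; exists y|apply/digitsE].
apply: card_eq_trans (lattice_digit_fiber lphi (digits w l fh)).
by apply: inj_card_eq => x y _ _; apply: scale_inj.
Qed.

End Net.

End ShiftedLattice.

Unset Implicit Arguments.

Theorem theorem7p1 (R : realType) (b n d : nat) (b_prime : prime b)
    (n_ge1 : (1 <= n)%N) (dE : d = (b ^ n)%N)
    (xi : 'I_d -> laurent 'F_b) (xi_inj : injective xi)
    (xi_roots : [set z | root (pd b n) z] = range xi) :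
  let T := lattice_mx xi in
  let X := lattice_of T in
  admissible R X /\
  forall (L Q : 'M[laurent 'F_b]_d) (f : 'cV[laurent 'F_b]_d),
    T = L *m Q ->
    is_trig_mx L ->
    (forall i j, (deg (Q i j) <= 0)%E) ->
    \det Q = 1 ->
    poly_vectors f ->
    (forall j, f j 0 != 0) ->
    (forall j : 'I_d,
       (\big[Order.max/-oo]_(i < d | (i <= j)%N) deg (L j i) <= deg (f j 0%R))%E) ->
    let mR : R := quality_bound b R d + \sum_j (fine (deg (f j 0)))%:~R in
    1 <= mR ->
    exists m t : nat,
      [/\ m%:R = mR, t%:R <= quality_bound b R d &
          is_net t m (scale_inv f X `&` unit_cube)].
Proof.
have b1 : (1 < b)%N := prime_gt1 b_prime.
case: d dE xi xi_inj xi_roots => [|d'] dE' xi' xi'_inj xi'_roots T X.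
  by move/eqP: dE'; rewrite eq_sym expn_eq0 eqn0Ngt (ltnW b1).
split; first exact: (lattice_admissible b_prime dE' xi'_inj xi'_roots R).
move=> L Q f TLQ L_trig Q_deg Q_det /poly_vectorsP[p fE] f0 L_f mR mR1.
pose phi (j : 'I_d'.+1) := (size (p j 0)).-1.
have f_ord j : ord (f j 0) = - (phi j)%:Z.
  have := f0 j; rewrite fE mxE lpoly_eq0 => pj0; rewrite ord_lpoly // /phi.
  by move: pj0; rewrite -size_poly_gt0; case: (size _) => //= s _; lia.
have f_deg j : deg (f j 0) = ((phi j)%:Z)%:E by rewrite degE // f_ord opprK.
have L_phi (i j : 'I_d'.+1) : (i <= j)%N -> lbound (- (phi j)%:Z) (L j i).
  move=> ij; apply/deg_leP; rewrite -f_deg; apply: le_trans (L_f j).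
  exact: le_bigmax_cond.
have Q_int i j : lbound 0 (Q i j) by rewrite -oppr0; apply/deg_leP.
have cardF : #|'F_b| = b by rewrite card_Fp.
pose D := absz (ord (\det (power_mx xi'))).
have := @ord_det_power_mx 'F_b n d'.+1 xi'; rewrite cardF.
move=> /(_ dE' xi'_inj (xi_rootP xi'_roots)); rewrite -/(power_mx xi') => D2.
(* By [D2] this order is at most 0, hence equal to minus its absolute value. *)
have DE : ord (\det (power_mx xi')) = - D%:Z.
  by move: D2; rewrite mulr2n /D; move: (ord _) (d'.+1 * _)%N => o N; lia.
have Dq : quality_bound b R d'.+1 = D%:R.
  rewrite dE'; apply: quality_boundE => //; rewrite -[in X in _ = (X * _)%N]dE'.
  by move: D2; rewrite DE mulr2n; move: (d'.+1 * _)%N => N; lia.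
have mE : (D + \sum_j phi j)%N%:R = mR.
  rewrite /mR Dq natrD natr_sum; congr (_ + _).
  by apply: eq_bigr => j _; rewrite f_deg.
(* The choice [t = D] meets the quality bound with equality. *)
exists (D + \sum_j phi j)%N, D; split=> //; first by rewrite Dq.
apply: (scaled_lattice_net b_prime dE' xi'_inj xi'_roots TLQ L_trig Q_int Q_det f0 f_ord L_phi DE).
by rewrite -(ler_nat R) mE.
Qed.
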